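(* Let $p>2$ be a prime, $\mathbf{F}$ a field of characteristic $p$, and $m,\ell\ge 0$ integers. If $m+\ell>2$, then $$(m+\ell)(p-1)\leq\beta(mV_2\oplus\ell V_3)\leq(m+\ell)(p-1)+1.$$
   Context: For $n\le p$, $V_n$ is the $n$-dimensional indecomposable representation over $\mathbf{F}$ of the cyclic group $\mathbf{Z}/p=\langle\sigma\rangle$ on which $\sigma$ acts by a single Jordan block with eigenvalue $1$; $mV_n$ is the direct sum of $m$ copies. For a representation $V$, the action on $V^*$ extends to algebra automorphisms of $\mathbf{F}[V]=S(V^* )$. The Noether number $\beta(V)$ is the least integer $d$ such that the ring of invariants $\mathbf{F}[V]^{\mathbf{Z}/p}$ is generated as an $\mathbf{F}$-algebra by homogeneous elements of degree at most $d$. *)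

(* Defs.v *)
From HB Require Import structures.
From mathcomp Require Import all_boot all_order all_algebra.
From mathcomp Require Import all_fingroup all_solvable all_field all_character.
From mathcomp.multinomials Require Import mpoly.

Set Implicit Arguments.
Unset Strict Implicit.
Unset Printing Implicit Defensive.

Import GRing.Theory.

Local Open Scope ring_scope.

Section GeneratedSubalgebra.

Variables (F : fieldType) (n : nat).

(* The smallest F-subalgebra containing S. *)
Inductive subalg_gen (S : {mpoly F[n]} -> Prop) : {mpoly F[n]} -> Prop :=
  | subalg_gen_in f : S f -> subalg_gen S f
  | subalg_gen_cst c : subalg_gen S c%:MP
  | subalg_gen_add f g :
      subalg_gen S f -> subalg_gen S g -> subalg_gen S (f + g)
  | subalg_gen_mul f g :
      subalg_gen S f -> subalg_gen S g -> subalg_gen S (f * g).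

End GeneratedSubalgebra.

Section Invariants.

Variables (F : fieldType) (gT : finGroupType) (G : {group gT}).
Variable V : representation F G.

(* F[V] = S(V^* ) is {mpoly F[rdegree V]}, where 'X_i is the i-th coordinate
   function on V, whose elements are row vectors v with g acting by
   v *m V g. The action on V^* is (g . phi)(v) = phi(v *m V g^-1), so 'X_i is
   sent to the sum over j of (V g^-1) j i *: 'X_j. *)
Definition poly_act (g : gT) (f : {mpoly F[rdegree V]}) : {mpoly F[rdegree V]} :=
  f \mPo [tuple \sum_(j < rdegree V) V (g^-1)%g j i *: 'X_j | i < rdegree V].

Definition poly_invariant (f : {mpoly F[rdegree V]}) : Prop :=
  forall g, g \in G -> poly_act g f = f.

Definition invariants_generated_upto (d : nat) : Prop :=
  exists S : {mpoly F[rdegree V]} -> Prop,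
    (forall f, S f -> exists2 k, (k <= d)%N & f \is k.-homog) /\
    (forall f, poly_invariant f <-> subalg_gen S f).

Definition is_noether_number (d : nat) : Prop :=
  invariants_generated_upto d /\
  (forall e, invariants_generated_upto e -> (d <= e)%N).

End Invariants.

Section CyclicRepresentations.

Variables (F : fieldType) (p : nat).

Definition jordan_block (n : nat) : 'M[F]_n :=
  \matrix_(i, j) ((j == i) || (j == i.+1 :> nat))%:R.

Lemma jordan_blockXp n :
  p \in [pchar F] -> (n <= p)%N -> jordan_block n ^+ p = 1.
Proof.
case: n => [|n] chFp le_np; first by apply/matrixP=> - [].
pose N : 'M[F]_n.+1 := \matrix_(i, j) (j == i.+1 :> nat)%:R.
have JE : jordan_block n.+1 = 1 + N.
  apply/matrixP=> i j; rewrite !mxE eq_sym -val_eqE /=.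
  case: (eqVneq (i : nat) j) => [->|_] /=; last by rewrite add0r.
  by rewrite (ltn_eqF (ltnSn j)) addr0.
have NX k : N ^+ k = \matrix_(i, j) (j == (i + k)%N :> nat)%:R.
  elim: k => [|k IHk].
    by apply/matrixP=> i j; rewrite expr0 !mxE addn0 eq_sym.
  apply/matrixP=> i j; rewrite exprSr IHk -mulmxE !mxE.
  have [lt_ik | le_ik] := ltnP (i + k) n.+1.
    rewrite (bigD1 (Ordinal lt_ik)) //= !mxE eqxx mul1r big1 ?addr0 ?addnS //.
    by move=> a; rewrite -val_eqE /= !mxE => /negbTE ->; rewrite mul0r.
  rewrite big1 => [|a _]; last first.
    by rewrite !mxE ltn_eqF ?mul0r // (leq_trans (ltn_ord a)).
  by rewrite ltn_eqF // (leq_trans (ltn_ord j)) // addnS leqW.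
have chMp : p \in [pchar 'M[F]_n.+1] by rewrite pchar_lalg.
rewrite JE -(pFrobenius_autE chMp) pFrobenius_autD_comm; last exact: commr_sym (commr1 _).
rewrite !pFrobenius_autE expr1n NX [X in 1 + X](_ : _ = 0) ?addr0 //.
apply/matrixP=> i j; rewrite !mxE ltn_eqF //.
by rewrite (leq_trans (ltn_ord j)) // (leq_trans le_np) ?leq_addl.
Qed.

Variables (chFp : p \in [pchar F]) (n : nat) (le_np : (n <= p)%N).

Lemma jordan_block_repr :
  mx_repr [set: 'Z_p] (fun g : 'Z_p => jordan_block n ^+ g).
Proof.
have p_gt1 : (1 < p)%N := prime_gt1 (pcharf_prime chFp).
split=> [|g h _ _]; first by rewrite expr0.
rewrite mulmxE -exprD [RHS](_ : _ = jordan_block n ^+ (g + h)) //.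
have -> : nat_of_ord (g * h)%g = ((g + h) %% p)%N.
  by congr (_ %% _)%N; apply: Zp_cast.
rewrite [in RHS](divn_eq (g + h) p) exprD mulnC exprM.
by rewrite jordan_blockXp // expr1n mul1r.
Qed.

(* V_n: the generator 1 of the additive group 'Z_p is sent to the Jordan block
   of size n with eigenvalue 1. *)
Definition Vrep : representation F [set: 'Z_p] :=
  Representation (MxRepresentation jordan_block_repr).

End CyclicRepresentations.

(* Main.v *)
(** Let s be the generator of Z/p acting on the polynomials in the k = m + l blocks
    of coordinates: s w = w + v, s v = v + x, s x = x for V_3, and v = x for V_2.

    Upper bound. Let f be an invariant of degree d > k (p - 1) + 1. Split it
    according to its degree in each block; as d > k (p - 1), only pieces of degree
    at least p in some block occur. Dividing such a piece by the norm N of w leaves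
    an invariant remainder r of degree < p in w. Modulo x (for V_3) the values of r
    at w = - c v, c in F_p, are conjugate, and Lagrange interpolation writes r as a
    transfer: s permutes both the nodes and the interpolation basis. Hence
    f = N q + x q' + Tr h with q, q' invariant. Finally Tr h decomposes, because h
    lies in the ideal generated by the invariants of degree between 1 and p: this
    ideal contains x_i, v_i v_j and w_i^p, hence all monomials of degree
    > k (p - 1) + 1.

    Lower bound. Let M = v_0^(p-1) prod_(i <> 0) w_i^(p-1). The coefficient of M in
    Tr (prod_i w_i^(p-1)) is sum_(c in F_p) c^(p-1) = -1. On monomials of degree < p
    in the v's, an s-invariant is killed by the derivation sum_i v_i d/dw_i, and
    this forces the coefficient of v_0^d prod_(i <> 0) w_i^(e_i) to vanish when
    d < p - 1, e_i < p and d < sum_i e_i. As k > 2, the coefficient of M in a product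
    of two invariants without constant term is therefore zero. *)
Require Import Defs.
From HB Require Import structures.
From mathcomp Require Import all_boot all_order all_algebra.
From mathcomp Require Import all_fingroup all_solvable all_field all_character.
From mathcomp.multinomials Require Import mpoly.
From mathcomp Require Import zify ring.
From Stdlib Require Classical_Prop.

Set Implicit Arguments.
Unset Strict Implicit.
Unset Printing Implicit Defensive.

Import GRing.Theory.

Local Open Scope ring_scope.

(** * Polynomials: substitutions, divisibility by monomials, homogeneous components *)

Section MPolyComplements.

Variables (F : fieldType) (n : nat).
Implicit Types f g : {mpoly F[n]}.

Lemma mpoly_gen_ind (P : {mpoly F[n]} -> Prop) :
    (forall c, P c%:MP) -> (forall i, P 'X_i) ->
    (forall f g, P f -> P g -> P (f + g)) ->
    (forall f g, P f -> P g -> P (f * g)) ->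
  forall f, P f.
Proof.
move=> PC PX PD PM; have P1 : P 1 by rewrite -mpolyC1.
have PXm m : P 'X_[m].
  rewrite mpolyXE_id; elim/big_ind: _ => // i _.
  by elim: (m i) => [|k IHk]; rewrite ?expr0 // exprS; apply: PM.
elim/mpolyind => [|c m f _ _ Pf]; first by rewrite -mpolyC0.
by apply: PD => //; rewrite -mul_mpolyC; apply: PM.
Qed.

(* Kept opaque so that conversion never unfolds the substitutions built on it. *)
Lemma mpoly_subst (S : comNzRingType) (phi : {rmorphism F -> S}) (a : 'I_n -> S) :
  {u : {rmorphism {mpoly F[n]} -> S} |
    (forall c, u c%:MP = phi c) & (forall i, u 'X_i = a i)}.
Proof. by exists (mmap phi a) => [c|i] /=; rewrite ?mmapC // mmapX mmap1U. Qed.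

Lemma mderivXU i j : ('X_j : {mpoly F[n]})^`M(i) = (j == i)%:R.
Proof.
rewrite mderivX mnm1E; have [->|_] := eqVneq j i; last by rewrite scale0r.
have -> : (U_(i) - U_(i) = 0 :> 'X_{1..n})%MM.
  by apply/mnmP=> k; rewrite mnmBE mnm0E subnn.
by rewrite mpolyX0 scale1r.
Qed.

Lemma mcoeffXM m f m' :
  ('X_[m] * f)@_m' = if (m <= m')%MM then f@_(m' - m) else 0.
Proof.
case: ifPn => [le_mm' | nle]; first by rewrite mulrC -{1}(submK le_mm') addmC mcoeffMX.
apply/eqP; rewrite mcoeff_eq0 mulrC (perm_mem (msuppMX _ _)).
apply: contra nle => /mapP[m1 _ ->]; exact: lem_addr.
Qed.

Lemma mpolyX_dvd m f :
  (forall m', ~~ (m <= m')%MM -> f@_m' = 0) -> exists g, f = 'X_[m] * g.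
Proof.
move=> f0; exists (\sum_(m' <- msupp f) f@_m' *: 'X_[m' - m]).
rewrite mulr_sumr {1}[f]mpolyE; apply: eq_big_seq => m'.
rewrite mcoeff_msupp => fm_neq0; rewrite -scalerAr -mpolyXD addmC submK //.
by apply: contraNT fm_neq0 => /f0->.
Qed.

Section Kill.

Variable P : pred 'I_n.

(** The quotient by the ideal of the variables in [P], realised inside the same ring. *)
Definition kill : {rmorphism {mpoly F[n]} -> {mpoly F[n]}} :=
  s2val (mpoly_subst (@mpolyC n F) (fun j => if P j then 0 else 'X_j)).

Lemma killC c : kill c%:MP = c%:MP.
Proof. by rewrite /kill; case: mpoly_subst. Qed.

Lemma killX j : kill 'X_j = if P j then 0 else 'X_j.
Proof. by rewrite /kill; case: mpoly_subst. Qed.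

Lemma killXm m :
  kill 'X_[m] = if [exists j, P j && (m j != 0)] then 0 else 'X_[m].
Proof.
rewrite [in LHS]mpolyXE_id rmorph_prod; case: ifPn => [/existsP[j /andP[Pj mj]]|].
  by rewrite (bigD1 j) //= rmorphXn /= killX Pj expr0n (negPf mj) mul0r.
move=> /existsPn nP; rewrite [RHS]mpolyXE_id; apply: eq_bigr => j _.
rewrite rmorphXn /= killX; case: ifP => // Pj; have := nP j.
by rewrite Pj negbK => /eqP->.
Qed.

Lemma mcoeff_kill f m :
  (kill f)@_m = if [exists j, P j && (m j != 0)] then 0 else f@_m.
Proof.
elim/mpolyind: f => [|c m' f _ _ IHf]; first by rewrite rmorph0 mcoeff0 if_same.
rewrite rmorphD -mul_mpolyC rmorphM killC killXm !mcoeffD !mcoeffCM IHf.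
have [->|ne] := eqVneq m' m.
  by case: ifP => //; rewrite mcoeff0 mulr0 addr0.
case: ifP => _; first by rewrite mcoeff0 mulr0 add0r mcoeffX (negPf ne) mulr0 add0r.
by rewrite mcoeffX (negPf ne) mulr0 !add0r.
Qed.

End Kill.

Section Homogeneous.

Variables (mf : measure n) (u : {rmorphism {mpoly F[n]} -> {mpoly F[n]}}).
Hypothesis uC : forall c, u c%:MP = c%:MP.
Hypothesis uX : forall i, u 'X_i \is (mf U_(i)%MM).-homog for mf.

Lemma rmorph_dhomogX m : u 'X_[m] \is (mf m).-homog for mf.
Proof.
rewrite mfE mpolyXE_id rmorph_prod /=.
apply: (big_ind2 (fun g d => g \is d.-homog for mf)).
- exact: dhomog1.
- by move=> g1 d1 g2 d2; apply: dhomogM.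
- by move=> i _; rewrite rmorphXn /= mulnC; apply: dhomogMn.
Qed.

(** A substitution sending each variable to a form of its own weight respects the grading. The
    measure is general because it serves both the total degree and the degree in one block. *)
Lemma pihomog_rmorph d f : pihomog mf d (u f) = u (pihomog mf d f).
Proof.
have uZ c g : u (c *: g) = c *: u g by rewrite -!mul_mpolyC rmorphM uC.
elim/mpolyind: f => [|c m f _ _ IHf]; first by rewrite rmorph0 pihomog0 rmorph0.
rewrite rmorphD !pihomogD rmorphD IHf uZ !linearZ /= uZ pihomogX.
congr (_ *: _ + _); case: eqVneq => [<-|ne_md].
  by rewrite pihomog_dE // rmorph_dhomogX.
by rewrite rmorph0 (pihomog_ne0 ne_md) // rmorph_dhomogX.
Qed.

End Homogeneous.

Lemma mcoeff_pihomog (mf : measure n) d f m :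
  (pihomog mf d f)@_m = if mf m == d then f@_m else 0.
Proof.
elim/mpolyind: f => [|c m' f _ _ IHf]; first by rewrite pihomog0 mcoeff0 if_same.
rewrite pihomogD !mcoeffD linearZ /= !mcoeffZ IHf pihomogX.
have [-> |ne] := eqVneq m' m; first by case: ifP; rewrite ?mcoeff0 ?mulr0 ?addr0.
case: (mf m' == d); rewrite ?mcoeff0 ?mcoeffX ?(negPf ne) ?mulr0 ?add0r //.
all: by case: ifP => // _; rewrite addr0.
Qed.

Lemma pihomogM (mf : measure n) d e f g : f \is d.-homog for mf ->
  pihomog mf e (f * g) = if (d <= e)%N then f * pihomog mf (e - d) g else 0.
Proof.
(* The bound [s] is large enough for the index [e - d] to occur in the sum, even if that component
   of [g] is zero. *)
move=> fhom; pose s := maxn (mmeasure mf g) (e - d).+1.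
rewrite {1}(_ : g = \sum_(i < s) pihomog mf i g); last first.
  by apply: pihomog_partitionE; rewrite leq_maxl.
rewrite mulr_sumr linear_sum /=.
have hom i : f * pihomog mf i g \is (d + i).-homog for mf.
  by apply: dhomogM => //; apply: pihomogP.
case: leqP => [le_de | lt_ed].
  have lt : (e - d < s)%N by rewrite leq_maxr.
  rewrite (bigD1 (Ordinal lt)) //= pihomog_dE ?big1 ?addr0 //.
    move=> i; rewrite -val_eqE /= => ne; apply: (pihomog_ne0 _ (hom i)).
    by apply: contraNneq ne => <-; rewrite addKn.
  by have := hom (Ordinal lt); rewrite /= subnKC.
apply: big1 => i _; apply: (pihomog_ne0 _ (hom i)).
by rewrite gtn_eqF // (leq_trans lt_ed) ?leq_addr.
Qed.

End MPolyComplements.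

(** * Interpolation on the prime field *)

Section Lagrange.

Variables (R : idomainType) (p : nat).
Hypothesis chR : p \in [pchar R].
Variable y : R.
Hypothesis y_neq0 : y != 0.

Lemma mulrn_inj_lt_pchar c d :
  (c < p)%N -> (d < p)%N -> (y *+ c == y *+ d) = (c == d).
Proof.
wlog le_cd : c d / (c <= d)%N => [IH|] ltc ltd.
  by case/orP: (leq_total c d) => le; [apply: IH | rewrite eq_sym IH // eq_sym].
rewrite eq_sym -subr_eq0 -mulrnBr // -mulr_natr mulf_eq0 (negPf y_neq0) /=.
rewrite -(dvdn_pcharf chR); case: eqVneq => [->|ne]; first by rewrite subnn dvdn0.
by apply/gtnNdvd; lia.
Qed.

Lemma fermat_pchar c d : (c < p)%N -> (d < p)%N ->
  y ^+ p.-1 - (y *+ c - y *+ d) ^+ p.-1 = (y ^+ p.-1) *+ (c == d).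
Proof.
have p_gt0 := prime_gt0 (pcharf_prime chR) => ltc ltd.
have [->|ne] := eqVneq c d.
  have := prime_gt1 (pcharf_prime chR).
  by rewrite subrr expr0n; case: (p) => [|[|q]] //= _; rewrite subr0.
rewrite /= mulr0n -(mulr_natr y c) -(mulr_natr y d) -mulrBr exprMn.
set z := c%:R - d%:R : R.
have z_neq0 : z != 0.
  have := mulrn_inj_lt_pchar ltc ltd; rewrite (negPf ne) => /negbT.
  rewrite -subr_eq0 -(mulr_natr y c) -(mulr_natr y d) -mulrBr mulf_eq0.
  by rewrite (negPf y_neq0).
(* Fermat: the Frobenius fixes the images of integers. *)
have zp : z ^+ p = z.
  by rewrite -(pFrobenius_autE chR) pFrobenius_autB_comm ?pFrobenius_aut_nat //; apply: mulrC.
have -> : z ^+ p.-1 = 1.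
  by apply: (mulfI z_neq0); rewrite -exprS prednK // zp mulr1.
by rewrite mulr1 subrr.
Qed.

(* Lagrange interpolation at the points - c y, c in F_p: by Fermat the c-th
   basis polynomial is (y^(p-1) - (X + c y)^(p-1)) / y^(p-1). *)
Lemma lagrange_pchar (r : {poly R}) : (size r <= p)%N ->
  \sum_(c < p) (r.[- (y *+ c)])%:P *
     ((y ^+ p.-1)%:P - ('X + (y *+ c)%:P) ^+ p.-1) = y ^+ p.-1 *: r.
Proof.
have p_gt0 := prime_gt0 (pcharf_prime chR) => szr; apply/eqP; rewrite -subr_eq0.
(* The difference of the two sides has size at most [p] but vanishes at all [p] nodes. *)
set q := _ - _; apply/idPn => q_neq0.
pose rs := [seq - (y *+ c) | c <- iota 0 p].
have szq : (size q <= p)%N.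
  rewrite (leq_trans (size_polyD _ _)) // geq_max size_polyN.
  rewrite (leq_trans (size_scale_leq _ _)) // andbT.
  apply: (leq_trans (size_sum _ _ _)); apply/bigmax_leqP => c _.
  rewrite mul_polyC (leq_trans (size_scale_leq _ _)) //.
  rewrite (leq_trans (size_polyD _ _)) // geq_max size_polyN.
  rewrite (leq_trans (size_polyC_leq1 _)) //=.
  by rewrite -[(y *+ c)%:P]opprK -polyCN size_exp_XsubC prednK.
have : (size rs < size q)%N.
  apply: max_poly_roots => //; last first.
    rewrite map_inj_in_uniq ?iota_uniq // => c d; rewrite !mem_iota !add0n /= => ltc ltd.
    by move/oppr_inj/eqP; rewrite mulrn_inj_lt_pchar // => /eqP.
  apply/allP => _ /mapP[d + ->]; rewrite mem_iota add0n /= => ltd.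
  rewrite /root hornerD hornerN hornerZ horner_sum subr_eq0.
  rewrite (bigD1 (Ordinal ltd)) //= big1 ?addr0 => [|c ne].
    by rewrite !hornerE [- _ + _]addrC fermat_pchar // eqxx mulrC.
  by rewrite !hornerE [- _ + _]addrC fermat_pchar // (negPf (ne : c != d :> nat)) mulr0.
by rewrite size_map size_iota ltnNge szq.
Qed.

End Lagrange.

(** Cyclic reindexing, with a function on Z/q represented by a sequence on [nat]; it gives the
    invariance of transfers and norms. *)
Lemma big_ord_shift (S : Type) (idx : S) (op : Monoid.com_law idx) q (a : nat -> S) :
  a q = a 0%N -> \big[op/idx]_(c < q) a c.+1 = \big[op/idx]_(c < q) a c.
Proof.
case: q => [|q] aq; first by rewrite !big_ord0.
by rewrite big_ord_recr aq [RHS]big_ord_recl /= Monoid.mulmC.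
Qed.

(** Vandermonde's identity; it makes [shift] additive in its exponent. *)
Lemma bin2D c d : 'C(c + d, 2) = ('C(c, 2) + 'C(d, 2) + c * d)%N.
Proof.
elim: c => [|c IHc]; first by rewrite mul0n addn0.
by rewrite addSn !binS !bin1 IHc mulSn addnACA addnAC; lia.
Qed.

(** * The action on a sum of Jordan blocks *)

Section BlockDegree.

Variables (n k : nat) (blk : 'I_n -> 'I_k) (i : 'I_k).

Definition bdeg (m : 'X_{1..n}) := (\sum_(j | blk j == i) m j)%N.

Lemma bdeg0 : bdeg 0%MM = 0%N.
Proof. by rewrite /bdeg big1 // => j _; rewrite mnm0E. Qed.

Lemma bdegD : {morph bdeg : m1 m2 / (m1 + m2)%MM >-> (m1 + m2)%N}.
Proof.
by move=> m1 m2; rewrite /bdeg -big_split; apply: eq_bigr => j _; rewrite mnmDE.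
Qed.

HB.instance Definition _ := isMeasure.Build n bdeg bdeg0 bdegD.

Lemma bdegU j : bdeg U_(j)%MM = (blk j == i).
Proof.
rewrite /bdeg big_mkcond (bigD1 j) //= mnm1E eqxx big1 => [|j' ne].
  by rewrite addn0; case: ifP.
by rewrite mnm1E [j == _]eq_sym (negPf ne) if_same.
Qed.

End BlockDegree.

Section Shift.

Variables (F : fieldType) (p : nat).
Hypotheses (chFp : p \in [pchar F]) (p_gt2 : (2 < p)%N).
Variables (n k : nat) (blk : 'I_n -> 'I_k) (x v w : 'I_k -> 'I_n).
(** [t i] singles out the blocks of type V_3. In a block of type V_2 the names [x i] and [v i]
    denote the same variable, so that both types are treated together. *)
Variable t : 'I_k -> bool.
Hypotheses (blkx : cancel x blk) (blkv : cancel v blk) (blkw : cancel w blk).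
Hypotheses (wNv : forall i, w i != v i) (wNx : forall i, w i != x i).
Hypothesis xv : forall i, (x i == v i) = ~~ t i.
Hypothesis cover :
  forall j, [|| j == w (blk j), j == v (blk j) | j == x (blk j)].

Implicit Types (f g h : {mpoly F[n]}) (i : 'I_k) (m : 'X_{1..n}).

Lemma var_ind (P : 'I_n -> Prop) :
  (forall i, P (w i)) -> (forall i, P (v i)) -> (forall i, P (x i)) ->
  forall j, P j.
Proof. by move=> Pw Pv Px j; case/or3P: (cover j) => /eqP->. Qed.

Lemma block_eq (y z : 'I_k -> 'I_n) (yK : cancel y blk) (zK : cancel z blk) i j :
  (y i == z j) = (i == j) && (y i == z i).
Proof.
have [<-|ne] /= := eqVneq i j; first by [].
by apply: contraNF ne => /eqP/(congr1 blk); rewrite yK zK => ->.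
Qed.

(** The power s^c of the generator, read off (1 + N)^c = 1 + c N + C(c, 2) N^2 with N^3 = 0. The
    exponent is a natural number, which matters only modulo [p] by [shiftD] and [shift0p]. *)
Definition shift_var c (j : 'I_n) : {mpoly F[n]} :=
  if j == w (blk j) then
    'X_j + 'X_(v (blk j)) *+ c
      + (if t (blk j) then 'X_(x (blk j)) *+ 'C(c, 2) else 0)
  else if t (blk j) && (j == v (blk j)) then 'X_j + 'X_(x (blk j)) *+ c
  else 'X_j.

Definition shift c : {rmorphism {mpoly F[n]} -> {mpoly F[n]}} :=
  s2val (mpoly_subst (@mpolyC n F) (shift_var c)).

Lemma shiftX c j : shift c 'X_j = shift_var c j.
Proof. by rewrite /shift; case: mpoly_subst. Qed.

Lemma shiftC c a : shift c a%:MP = a%:MP.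
Proof. by rewrite /shift; case: mpoly_subst. Qed.

Lemma shift_w c i : shift c 'X_(w i) =
  'X_(w i) + 'X_(v i) *+ c + (if t i then 'X_(x i) *+ 'C(c, 2) else 0).
Proof. by rewrite shiftX /shift_var blkw eqxx. Qed.

Lemma shift_v c i :
  shift c 'X_(v i) = 'X_(v i) + (if t i then 'X_(x i) *+ c else 0).
Proof.
rewrite shiftX /shift_var blkv eq_sym (negPf (wNv i)) eqxx andbT.
by case: (t i); rewrite ?addr0.
Qed.

Lemma shift_x c i : shift c 'X_(x i) = 'X_(x i).
Proof.
rewrite shiftX /shift_var blkx eq_sym (negPf (wNx i)) xv.
by case: (t i).
Qed.

Definition shiftE := (shift_w, shift_v, shift_x).

Lemma shiftD c d f : shift (c + d) f = shift c (shift d f).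
Proof.
elim/mpoly_gen_ind: f => [a||f g IHf IHg|f g IHf IHg].
- by rewrite !shiftC.
- apply: var_ind => i; rewrite !shiftE ?rmorphD ?rmorphMn /= ?shiftE.
  + case: (t i); last by rewrite ?rmorph0 !addr0 mulrnDr addrA.
    rewrite !rmorphMn /= !shiftE bin2D; ring.
  + case: (t i); last by rewrite ?rmorph0 !addr0.
    by rewrite rmorphMn /= shiftE mulrnDr addrA.
  + by [].
- by rewrite !rmorphD IHf IHg.
- by rewrite !rmorphM IHf IHg.
Qed.

Lemma mpoly_mulrn_dvd f c : (p %| c)%N -> f *+ c = 0.
Proof.
by move=> dv; rewrite -scaler_nat (eqP (_ : c%:R == 0 :> F)) ?scale0r -?(dvdn_pcharf chFp).
Qed.

Lemma shift0p c f : (p %| c)%N -> shift c f = f.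
Proof.
move=> dv; have p_pr := pcharf_prime chFp.
(* Here [p] is odd: it divides 2 C(c, 2) = c (c - 1) and is prime to 2. *)
have dv2 : (p %| 'C(c, 2))%N.
  have: (p %| 'C(c, 2) * 2)%N by rewrite -[X in (_ * X)%N]/(2`!) bin_ffact ffactnS dvdn_mulr.
  by rewrite Gauss_dvdl // prime_coprime // gtnNdvd.
elim/mpoly_gen_ind: f => [a||f g IHf IHg|f g IHf IHg].
- by rewrite shiftC.
- by apply: var_ind => i; rewrite shiftE ?mpoly_mulrn_dvd ?if_same ?addr0.
- by rewrite rmorphD IHf IHg.
- by rewrite rmorphM IHf IHg.
Qed.

Definition inv f := shift 1 f = f.

Lemma inv_shift c f : inv f -> shift c f = f.
Proof.
move=> invf; elim: c => [|c IHc]; first by rewrite shift0p.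
by rewrite -add1n shiftD IHc.
Qed.

Lemma invD f g : inv f -> inv g -> inv (f + g).
Proof. by rewrite /inv rmorphD => -> ->. Qed.

Lemma invB f g : inv f -> inv g -> inv (f - g).
Proof. by rewrite /inv rmorphB => -> ->. Qed.

Lemma invM f g : inv f -> inv g -> inv (f * g).
Proof. by rewrite /inv rmorphM => -> ->. Qed.

Lemma invMl f g : f != 0 -> inv f -> inv (f * g) -> inv g.
Proof.
by move=> nz invf; rewrite /inv rmorphM invf => /(mulfI nz).
Qed.

Lemma shift_homog c j : shift c 'X_j \is 1.-homog.
Proof.
have X1 j' : 'X_j' \is [in F[n], 1.-homog] by rewrite dhomogX /= mdeg1.
by move: j; apply: var_ind => i; rewrite shiftE; case: (t i);
  rewrite ?addr0; rewrite ?rpredD ?rpredMn.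
Qed.

Lemma shift_bhomog b c j : shift c 'X_j \is (blk j == b).-homog for (bdeg blk b).
Proof.
have X1 j' : ('X_j' : {mpoly F[n]}) \is (blk j' == b).-homog for (bdeg blk b).
  by rewrite dhomogX /= bdegU.
move: j; apply: var_ind => i.
- have := (X1 (w i), X1 (v i), X1 (x i)); rewrite blkx blkv blkw => -[[? ?] ?].
  by rewrite shiftE; case: (t i); rewrite ?addr0; rewrite ?rpredD ?rpredMn.
- have := (X1 (w i), X1 (v i), X1 (x i)); rewrite blkx blkv blkw => -[[? ?] ?].
  by rewrite shiftE; case: (t i); rewrite ?addr0; rewrite ?rpredD ?rpredMn.
by rewrite shiftE.
Qed.

Lemma pihomog_shift c d f : pihomog mdeg d (shift c f) = shift c (pihomog mdeg d f).
Proof.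
apply: pihomog_rmorph => [a|j]; first exact: shiftC.
by rewrite /= mdeg1; apply: shift_homog.
Qed.

Lemma pibhomog_shift b c d f :
  pihomog (bdeg blk b) d (shift c f) = shift c (pihomog (bdeg blk b) d f).
Proof.
apply: pihomog_rmorph => [a|j]; first exact: shiftC.
by rewrite /= bdegU; apply: shift_bhomog.
Qed.

Lemma inv_pihomog d f : inv f -> inv (pihomog mdeg d f).
Proof. by rewrite /inv -pihomog_shift => ->. Qed.

Lemma inv_pibhomog b d f : inv f -> inv (pihomog (bdeg blk b) d f).
Proof. by rewrite /inv -pibhomog_shift => ->. Qed.

Definition transfer f := \sum_(c < p) shift c f.

Lemma inv_transfer f : inv (transfer f).
Proof.
rewrite /inv /transfer rmorph_sum /=.
rewrite (eq_bigr (fun c : 'I_p => shift c.+1 f)) => [|c _]; last by rewrite -shiftD.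
by rewrite (big_ord_shift _ (a := fun c => shift c f)) // !shift0p.
Qed.

Lemma transferD f g : transfer (f + g) = transfer f + transfer g.
Proof. by rewrite -big_split; apply: eq_bigr => c _; rewrite rmorphD. Qed.

Lemma transferMl f g : inv f -> transfer (f * g) = f * transfer g.
Proof.
move=> invf; rewrite mulr_sumr; apply: eq_bigr => c _.
by rewrite rmorphM /= inv_shift.
Qed.

Lemma pihomog_transfer d f :
  pihomog mdeg d (transfer f) = transfer (pihomog mdeg d f).
Proof. by rewrite linear_sum; apply: eq_bigr => c _; rewrite /= pihomog_shift. Qed.

Definition orbit_norm i := \prod_(c < p) shift c 'X_(w i).

Lemma inv_norm i : inv (orbit_norm i).
Proof.
rewrite /inv /orbit_norm rmorph_prod /=.
rewrite (eq_bigr (fun c : 'I_p => shift c.+1 'X_(w i))) => [|c _]; last by rewrite -shiftD.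
by rewrite (big_ord_shift _ (a := fun c => shift c 'X_(w i))) // !shift0p.
Qed.

Lemma norm_homog i : orbit_norm i \is p.-homog.
Proof.
(* Written as a sum, the degree accumulates along the product. *)
have -> : p = (\sum_(c < p) 1)%N by rewrite sum1_card card_ord.
apply: (big_ind2 (fun g d => g \is [in F[n], d.-homog])).
- exact: dhomog1.
- by move=> g1 d1 g2 d2; apply: dhomogM.
- by move=> c _; apply: shift_homog.
Qed.

(** * Upper bound *)

(** The Hilbert ideal with bounded generators. In the induction on the degree, positivity makes the
    cofactor of a generator smaller, and the bound [p] makes the generator itself smaller. *)
Inductive hilbert_ideal : {mpoly F[n]} -> Prop :=
  | hilbert_gen d g h : inv g -> g \is d.-homog -> (0 < d <= p)%N ->
      hilbert_ideal (g * h)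
  | hilbert_add f g : hilbert_ideal f -> hilbert_ideal g -> hilbert_ideal (f + g).

Lemma hilbertM f h : hilbert_ideal f -> hilbert_ideal (f * h).
Proof.
elim=> [d g h' ig gd dp|f1 f2 _ IH1 _ IH2]; last by rewrite mulrDl; apply: hilbert_add.
by rewrite -mulrA; apply: hilbert_gen gd dp.
Qed.

Lemma hilbert_x i : hilbert_ideal 'X_(x i).
Proof.
rewrite -['X_(x i)]mulr1; apply: (@hilbert_gen 1); first exact: shift_x.
  by rewrite dhomogX /= mdeg1.
by rewrite /= ltnW // ltnW.
Qed.

Lemma hilbert0 : hilbert_ideal 0.
Proof.
rewrite -(mul0r 0); apply: (@hilbert_gen 1); [exact: rmorph0 | exact: dhomog0 |].
by rewrite /= ltnW // ltnW.
Qed.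

Lemma hilbertN f : hilbert_ideal f -> hilbert_ideal (- f).
Proof. by move=> hf; rewrite -mulrN1; apply: hilbertM. Qed.

Lemma hilbertB f g : hilbert_ideal f -> hilbert_ideal g -> hilbert_ideal (f - g).
Proof. by move=> hf hg; apply: hilbert_add => //; apply: hilbertN. Qed.

Lemma hilbert_sum (I : Type) (r : seq I) (P : pred I) (a : I -> {mpoly F[n]}) :
  (forall j, P j -> hilbert_ideal (a j)) -> hilbert_ideal (\sum_(j <- r | P j) a j).
Proof. by move=> ha; elim/big_ind: _ => //; [apply: hilbert0 | apply: hilbert_add]. Qed.

Lemma hilbert_vv i j : hilbert_ideal ('X_(v i) * 'X_(v j)).
Proof.
case ti: (t i); last first.
  by rewrite (_ : v i = x i); [apply/hilbertM/hilbert_x | apply/esym/eqP; rewrite xv ti].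
case tj: (t j); last first.
  by rewrite mulrC (_ : v j = x j); [apply/hilbertM/hilbert_x | apply/esym/eqP; rewrite xv tj].
(* The quadratic invariant of two blocks of type V_3; it is v_i v_j modulo the x's. *)
pose q := 'X_(v i) * 'X_(v j) - 'X_(x i) * 'X_(w j) - 'X_(x j) * 'X_(w i)
          - 'X_(x i) * 'X_(v j) : {mpoly F[n]}.
have -> : 'X_(v i) * 'X_(v j) =
    q * 1 + ('X_(x i) * 'X_(w j) + 'X_(x j) * 'X_(w i) + 'X_(x i) * 'X_(v j)).
  by rewrite /q; ring.
apply: hilbert_add; last first.
  by do ?apply: hilbert_add; apply/hilbertM/hilbert_x.
apply: (@hilbert_gen 2); last by rewrite /= ltnW.
  by rewrite /inv !rmorphB !rmorphM /= !shiftE ti tj bin_small // !mulr1n /q; ring.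
have X2 a b : 'X_a * 'X_b \is [in F[n], 2.-homog].
  by apply: (@dhomogM _ _ _ 1 _ 1); rewrite dhomogX /= mdeg1.
by rewrite /q !rpredB.
Qed.

(** First-order expansion of the product: every further term contains two factors [u]. *)
Lemma hilbert_prod (q : nat) (W : {mpoly F[n]}) (u : nat -> {mpoly F[n]}) :
  (forall c d, hilbert_ideal (u c * u d)) ->
  hilbert_ideal (\prod_(c < q) (W + u c) - (W ^+ q + W ^+ q.-1 * \sum_(c < q) u c)).
Proof.
move=> uu; elim: q => [|q IHq].
  by rewrite !big_ord0 mulr0 addr0 expr0 subrr; apply: hilbert0.
rewrite !big_ord_recr /=.
set P := \prod_(c < q) _ in IHq *; set S := \sum_(c < q) _ in IHq *.
have WS : W * (W ^+ q.-1 * S) = W ^+ q * S.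
  (* For [q = 0] the exponent [q.-1] is truncated, but then the sum [S] is empty. *)
  case: (posnP q) => [q0|q_gt0]; last by rewrite mulrA -exprS prednK.
  by have -> : S = 0; [rewrite /S big1 // => -[c]; rewrite q0 | rewrite !mulr0].
have -> : P * (W + u q) - (W ^+ q.+1 + W ^+ q * (S + u q)) =
    (P - (W ^+ q + W ^+ q.-1 * S)) * (W + u q) + (S * u q) * W ^+ q.-1.
  rewrite exprS [_ ^+ q * (_ + _)]mulrDr -WS.
  by move: (W ^+ q) (W ^+ q.-1) => a b; ring.
apply: hilbert_add; apply: hilbertM => //.
by rewrite mulr_suml; apply: hilbert_sum => c _; apply: uu.
Qed.

(** The norm of w is w^p + w^(p-1) S modulo the ideal, where S, the sum of the differences s^c w -
    w, lies in the ideal too. *)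
Lemma hilbert_wp i : hilbert_ideal ('X_(w i) ^+ p).
Proof.
have p_gt0 : (0 < p)%N by rewrite ltnW // ltnW.
pose u c : {mpoly F[n]} :=
  'X_(v i) *+ c + (if t i then 'X_(x i) *+ 'C(c, 2) else 0).
have hx a : hilbert_ideal (if t i then 'X_(x i) *+ a else 0).
  case: (t i); last exact: hilbert0.
  by rewrite -mulr_natr; apply/hilbertM/hilbert_x.
have uu c d : hilbert_ideal (u c * u d).
  rewrite mulrDl; apply: hilbert_add; last exact: hilbertM.
  rewrite mulrDr; apply: hilbert_add; last by rewrite mulrC; apply: hilbertM.
  rewrite -mulr_natr -['X_(v i) *+ d]mulr_natr mulrACA.
  exact/hilbertM/hilbert_vv.
have := hilbert_prod p 'X_(w i) uu.
have -> : \prod_(c < p) ('X_(w i) + u c) = orbit_norm i.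
  by apply: eq_bigr => c _; rewrite shift_w addrA.
set S := \sum_(c < p) u c => hN.
have hS : hilbert_ideal S.
  rewrite /S big_split /=; apply: hilbert_add; last by apply: hilbert_sum.
  (* The coefficient of v in [S] is the sum of all c < p, that is C(p, 2), a multiple of [p]. *)
  rewrite sumrMnr.
  rewrite -(big_mkord xpredT (fun c => c)) bin2_sum mpoly_mulrn_dvd.
    exact: hilbert0.
  by rewrite prime_dvd_bin ?(pcharf_prime chFp) // p_gt2.
have -> : 'X_(w i) ^+ p = orbit_norm i * 1 -
    ((orbit_norm i - ('X_(w i) ^+ p + 'X_(w i) ^+ p.-1 * S)) + S * 'X_(w i) ^+ p.-1).
  by ring.
apply: hilbertB; last by apply: hilbert_add => //; apply: hilbertM.
by apply: hilbert_gen (inv_norm i) (norm_homog i) _; rewrite p_gt0 leqnn.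
Qed.

Lemma bdegE i m :
  bdeg blk i m = (m (w i) + (m (v i) + (if t i then m (x i) else 0)))%N.
Proof.
rewrite /bdeg (bigD1 (w i)) ?blkw //=; congr addn.
rewrite (bigD1 (v i)) /= ?blkv ?eqxx 1?eq_sym ?wNv //; congr addn.
case: ifP => ti.
  rewrite (bigD1 (x i)) /= ?blkx ?eqxx 1?[x i == w i]eq_sym ?wNx ?xv ?ti //.
  rewrite big_pred0 ?addn0 // => j; apply/negbTE; move: j.
  by apply: var_ind => i'; rewrite ?blkw ?blkv ?blkx; case: eqVneq => // ->;
    rewrite eqxx ?andbF.
rewrite big_pred0 // => j; apply/negbTE; move: j.
by apply: var_ind => i'; rewrite ?blkw ?blkv ?blkx; case: eqVneq => // ->;
  rewrite ?eqxx ?xv ?ti ?andbF.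
Qed.

Lemma mdeg_bdeg m : mdeg m = (\sum_i bdeg blk i m)%N.
Proof.
by rewrite mdegE (partition_big blk xpredT) //=.
Qed.

(** A monomial divisible by none of the known members x_i, w_i^p, v_i v_j has all w-exponents at
    most p - 1 and at most one v, to the first power. *)
Lemma hilbert_monomial m : (k * (p - 1) + 1 < mdeg m)%N -> hilbert_ideal 'X_[m].
Proof.
move=> dm.
have sub m' : hilbert_ideal 'X_[m'] -> (m' <= m)%MM -> hilbert_ideal 'X_[m].
  by move=> hm' le; rewrite -(submK le) addmC mpolyXD; apply: hilbertM.
have [/existsP[i mx]|/existsPn mx0] := boolP [exists i, m (x i) != 0%N].
  by apply: sub (hilbert_x i) _; rewrite lep1mP.
have [/existsP[i mw]|/existsPn mwp] := boolP [exists i, (p <= m (w i))%N].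
  apply: (sub (U_(w i) *+ p)%MM); first by rewrite -mpolyXn; apply: hilbert_wp.
  apply/mnm_lepP => j; rewrite mulmnE mnm1E.
  by case: eqVneq => [<-|_]; rewrite ?mul1n.
have [/existsP[i mv]|/existsPn mv1] := boolP [exists i, (1 < m (v i))%N].
  apply: (sub (U_(v i) + U_(v i))%MM); first by rewrite mpolyXD; apply: hilbert_vv.
  apply/mnm_lepP => j; rewrite mnmDE mnm1E.
  by case: eqVneq => [<-|_].
have [/existsP[i /existsP[j /and3P[ij mi mj]]]|/existsPn mv2] :=
  boolP [exists i, exists j, [&& i != j, 0 < m (v i) & 0 < m (v j)]%N].
  apply: (sub (U_(v i) + U_(v j))%MM); first by rewrite mpolyXD; apply: hilbert_vv.
  apply/mnm_lepP => j'; rewrite mnmDE !mnm1E.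
  case: eqVneq => [<-|_]; last by case: eqVneq => [<-|_].
  by rewrite (can_eq blkv) eq_sym (negPf ij).
suff: (mdeg m <= k * (p - 1) + 1)%N by rewrite leqNgt dm.
rewrite mdeg_bdeg; under eq_bigr => i _.
  rewrite bdegE (eqP (negbNE (mx0 i))) if_same addn0; over.
rewrite big_split /= leq_add //.
  rewrite -[X in (_ <= X * _)%N]card_ord -sum_nat_const; apply: leq_sum => i _.
  by have := mwp i; rewrite -ltnNge; lia.
have [/existsP[i mi]|/existsPn m0] := boolP [exists i, (0 < m (v i))%N].
  rewrite (bigD1 i) //= big1 ?addn0; first by have := mv1 i; rewrite -leqNgt.
  move=> j ji; apply/eqP; have /existsPn/(_ j) := mv2 i.
  by rewrite eq_sym ji mi /= lt0n negbK.
by rewrite big1 // => i _; apply/eqP; have := m0 i; rewrite lt0n negbK.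
Qed.

(** * Division by the norm, with respect to one variable w *)

(** Expansion in powers of [w i]. The coefficients stay in the full ring [{mpoly F[n]}], although
    those of an expansion are free of [w i]. *)
Definition upoly i : {rmorphism {mpoly F[n]} -> {poly {mpoly F[n]}}} :=
  s2val (mpoly_subst (polyC \o @mpolyC n F)
                     (fun j => if j == w i then 'X else ('X_j)%:P)).

Lemma upolyC i c : upoly i c%:MP = (c%:MP)%:P.
Proof. by rewrite /upoly; case: mpoly_subst. Qed.

Lemma upolyX i j : upoly i 'X_j = if j == w i then 'X else ('X_j)%:P.
Proof. by rewrite /upoly; case: mpoly_subst. Qed.

Lemma upolyXm i m : m (w i) = 0%N -> upoly i 'X_[m] = ('X_[m])%:P.
Proof.
move=> mw0; rewrite [in LHS]mpolyXE_id [in RHS]mpolyXE_id !rmorph_prod.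
apply: eq_bigr => j _; rewrite !rmorphXn /= upolyX.
by case: eqVneq => [->|_]; rewrite ?mw0 ?expr0.
Qed.

Lemma coef_upoly i f j m : (upoly i f)`_j@_m =
  if m (w i) == 0%N then f@_(m + U_(w i) *+ j) else 0.
Proof.
elim/mpolyind: f => [|c m' f _ _ IHf].
  by rewrite rmorph0 coef0 !mcoeff0 if_same.
pose e := m' (w i); pose m0 := (m' - U_(w i) *+ e)%MM.
have m0w : m0 (w i) = 0%N by rewrite mnmBE mulmnE mnm1E eqxx mul1n subnn.
have m'E : m' = (m0 + U_(w i) *+ e)%MM.
  rewrite submK //; apply/mnm_lepP => j'; rewrite mulmnE mnm1E.
  by case: eqVneq => [<-|_]; rewrite ?mul1n.
rewrite rmorphD -mul_mpolyC rmorphM upolyC coefD coefCM !mcoeffD !mcoeffCM IHf.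
rewrite {1}m'E mpolyXD -mpolyXn rmorphM rmorphXn /= upolyX eqxx (upolyXm m0w).
rewrite coefCM coefXn !mcoeffX; case: (eqVneq (m (w i)) 0%N) => [mw0|mwN0]; last first.
  rewrite addr0; case: (j == e); last by rewrite mulr0 mcoeff0 mulr0.
  rewrite mulr1 mcoeffX; case: eqVneq => [m0E|]; last by rewrite mulr0.
  by rewrite -m0E m0w in mwN0.
congr (_ * _ + _); have [->|ne] := eqVneq j e.
  by rewrite mulr1 mcoeffX m'E eqm_add2r.
rewrite mulr0 mcoeff0; case: eqVneq => // m'E2; case/eqP: ne.
have := congr1 (fun a : 'X_{1..n} => a (w i)) m'E2.
by rewrite mnmDE mulmnE mnm1E eqxx mul1n mw0.
Qed.

Lemma upolyK i f : (upoly i f).['X_(w i)] = f.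
Proof.
elim/mpoly_gen_ind: f => [a|j|f g IHf IHg|f g IHf IHg].
- by rewrite upolyC hornerC.
- by rewrite upolyX; case: eqVneq => [->|_]; rewrite ?hornerX ?hornerC.
- by rewrite rmorphD hornerD IHf IHg.
- by rewrite rmorphM hornerM IHf IHg.
Qed.

(** No variable [w j] occurs in this difference, so it is a constant for every [upoly j]. *)
Definition wshift i c : {mpoly F[n]} := shift c 'X_(w i) - 'X_(w i).

Definition ushift i c (q : {poly {mpoly F[n]}}) :=
  map_poly (shift c) q \Po ('X + (wshift i c)%:P).

Lemma ushiftD i c q r : ushift i c (q + r) = ushift i c q + ushift i c r.
Proof. by rewrite /ushift [map_poly _ _]rmorphD comp_polyD. Qed.

Lemma ushiftM i c q r : ushift i c (q * r) = ushift i c q * ushift i c r.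
Proof. by rewrite /ushift [map_poly _ _]rmorphM comp_polyM. Qed.

Lemma vNw i j : v i != w j.
Proof. by rewrite (block_eq blkv blkw) [v i == _]eq_sym (negPf (wNv i)) andbF. Qed.

Lemma xNw i j : x i != w j.
Proof. by rewrite (block_eq blkx blkw) [x i == _]eq_sym (negPf (wNx i)) andbF. Qed.

Lemma upoly_v i j : upoly i 'X_(v j) = ('X_(v j))%:P.
Proof. by rewrite upolyX (negPf (vNw _ _)). Qed.

Lemma upoly_x i j : upoly i 'X_(x j) = ('X_(x j))%:P.
Proof. by rewrite upolyX (negPf (xNw _ _)). Qed.

Lemma upoly_wshift i j c : upoly i (wshift j c) = (wshift j c)%:P.
Proof.
rewrite /wshift shift_w -[X in X - _]addrA [X in X - _]addrC addrK !rmorphD !rmorphMn /= upoly_v.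
by case: (t j); rewrite ?rmorph0 ?rmorphMn //= upoly_x.
Qed.

Lemma upoly_shift i c f : upoly i (shift c f) = ushift i c (upoly i f).
Proof.
elim/mpoly_gen_ind: f => [a||f g IHf IHg|f g IHf IHg].
- by rewrite shiftC upolyC /ushift map_polyC /= shiftC comp_polyC.
- apply: var_ind => j.
  + have shE : shift c 'X_(w j) = 'X_(w j) + wshift j c by rewrite addrC subrK.
    rewrite shE rmorphD upolyX upoly_wshift /ushift (can_eq blkw).
    have [->|ne] := eqVneq j i; first by rewrite map_polyX comp_polyX.
    by rewrite map_polyC /= comp_polyC shE -polyCD.
  + rewrite upoly_v /ushift map_polyC /= comp_polyC shift_v !rmorphD /= upoly_v.
    by case: (t j); rewrite ?rmorph0 ?rmorphMn //= upoly_x.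
  + by rewrite shift_x upoly_x /ushift map_polyC /= comp_polyC shift_x.
- by rewrite !rmorphD ushiftD IHf IHg.
- by rewrite !rmorphM ushiftM IHf IHg.
Qed.

Lemma horner_ushift i c q :
  (ushift i c q).['X_(w i)] = shift c q.['X_(w i)].
Proof.
rewrite /ushift horner_comp hornerD hornerX hornerC /wshift addrC subrK.
by rewrite horner_map.
Qed.

Lemma size_ushift i c q : (size (ushift i c q) <= size q)%N.
Proof.
rewrite /ushift size_comp_poly2 ?size_poly //.
by rewrite -[(wshift i c)%:P]opprK -polyCN size_XsubC.
Qed.

Lemma upoly_norm_monic i :
  upoly i (orbit_norm i) \is monic /\ size (upoly i (orbit_norm i)) = p.+1.
Proof.
have -> : upoly i (orbit_norm i) = \prod_(c < p) ('X - (- wshift i c)%:P).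
  rewrite rmorph_prod; apply: eq_bigr => c _; rewrite polyCN opprK.
  have -> : shift c 'X_(w i) = 'X_(w i) + wshift i c by rewrite addrC subrK.
  by rewrite rmorphD upolyX eqxx upoly_wshift.
by split; [apply: monic_prod_XsubC | rewrite size_prod_XsubC /index_enum -enumT size_enum_ord].
Qed.

(** By this uniqueness, an operation fixing dividend and divisor, and not increasing the size of the
    remainder, fixes quotient and remainder. *)
Lemma monic_div_uniq (R : nzRingType) (d q1 q2 r1 r2 : {poly R}) : d \is monic ->
    q1 * d + r1 = q2 * d + r2 -> (size r1 < size d)%N -> (size r2 < size d)%N ->
  q1 = q2 /\ r1 = r2.
Proof.
move=> mon eqd sz1 sz2.
have dm := Pdiv.RingMonic.rdivp_addl_mul_small mon.
have rm := Pdiv.RingMonic.rmodp_addl_mul_small mon.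
by split; [rewrite -(dm q1 _ sz1) eqd dm | rewrite -(rm q1 _ sz1) eqd rm].
Qed.

Lemma norm_division i f : inv f ->
  exists Q R, [/\ f = Q * orbit_norm i + R, inv Q, inv R & (size (upoly i R) <= p)%N].
Proof.
move=> invf; have [Nmon Nsz] := upoly_norm_monic i.
set N := upoly i _ in Nmon Nsz.
pose q := Pdiv.Ring.rdivp (upoly i f) N; pose r := Pdiv.Ring.rmodp (upoly i f) N.
have fE : upoly i f = q * N + r by apply: Pdiv.RingMonic.rdivp_eq.
have rsz : (size r < size N)%N.
  by apply: Pdiv.Ring.ltn_rmodpN0; apply: monic_neq0.
(* Setting [w i] to 0 in the coefficients fixes dividend and divisor, hence also the remainder,
   whose coefficients are therefore free of [w i]. *)
pose K0 := kill F (pred1 (w i)).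
have K0u g : map_poly K0 (upoly i g) = upoly i g.
  elim/mpoly_gen_ind: g => [a|j|g1 g2 IH1 IH2|g1 g2 IH1 IH2].
  - by rewrite upolyC map_polyC /= killC.
  - rewrite upolyX; case: eqVneq => [_|ne]; first by rewrite map_polyX.
    by rewrite map_polyC /= killX /= (negPf ne).
  - by rewrite [upoly i _]rmorphD [map_poly _ _]rmorphD /= IH1 IH2.
  - by rewrite [upoly i _]rmorphM [map_poly _ _]rmorphM /= IH1 IH2.
have uK0 g : upoly i (K0 g) = (K0 g)%:P.
  elim/mpoly_gen_ind: g => [a|j|g1 g2 IH1 IH2|g1 g2 IH1 IH2].
  - by rewrite killC upolyC.
  - rewrite killX /=; case: ifPn => [_|ne]; first by rewrite !rmorph0.
    by rewrite upolyX (negPf ne).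
  - by rewrite !rmorphD IH1 IH2.
  - by rewrite !rmorphM IH1 IH2.
have [_ K0r] : map_poly K0 q = q /\ map_poly K0 r = r.
  apply: (monic_div_uniq Nmon) => //.
    apply/esym; rewrite -fE -[LHS]K0u fE [map_poly _ _]rmorphD rmorphM /=.
    by rewrite K0u.
  by rewrite (leq_ltn_trans (size_poly _ _)).
(* The same uniqueness, applied to the action, gives invariance. *)
have [shq shr] : ushift i 1 q = q /\ ushift i 1 r = r.
  apply: (monic_div_uniq Nmon) => //; last by rewrite (leq_ltn_trans (size_ushift _ _ _)).
  have {1}-> : N = ushift i 1 N by rewrite -upoly_shift inv_norm.
  by rewrite -ushiftM -ushiftD -fE -upoly_shift invf.
exists q.['X_(w i)], r.['X_(w i)]; split.
- by rewrite -{1}[f](upolyK i) fE hornerD hornerM upolyK.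
- by rewrite /inv -horner_ushift shq.
- by rewrite /inv -horner_ushift shr.
rewrite -horner_map /= upolyX eqxx.
(* Since the coefficients of [r] are free of [w i], expanding the value of [r] at [w i] gives back
   [r], and the size is kept. *)
have -> : map_poly (upoly i) r = map_poly polyC r.
  apply/polyP => j; rewrite !coef_map /= -[in LHS]K0r -[in RHS]K0r coef_map /=.
  exact: uK0.
by rewrite -[_.['X]]/(r \Po 'X) comp_polyXr -ltnS -Nsz.
Qed.

Lemma mpolyX_neq0 m : 'X_[m] != 0 :> {mpoly F[n]}.
Proof. by rewrite -msupp_eq0 msuppX. Qed.

Lemma upoly_free i f : (forall m, m (w i) != 0%N -> f@_m = 0) -> upoly i f = f%:P.
Proof.
move=> f0; apply/polyP => j; apply/mpolyP => m; rewrite coef_upoly coefC.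
case: j => [|j] /=; first by rewrite mulm0n addm0; case: eqVneq => // /f0->.
rewrite mcoeff0 f0 ?if_same // mnmDE mulmnE mnm1E eqxx mul1n addnS //.
Qed.

(** * Invariants of small degree in w are transfers modulo x *)

Section ModuloX.

Variable i : 'I_k.

(** The identity on a block of type V_2, where [x i] is [v i] and has to survive. *)
Definition kill_x := kill F [pred j | t i && (j == x i)].

Lemma kill_x_x : kill_x 'X_(x i) = if t i then 0 else 'X_(x i).
Proof. by rewrite killX /= eqxx andbT. Qed.

Lemma kill_x_v : kill_x 'X_(v i) = 'X_(v i).
Proof. by rewrite killX /= eq_sym xv andbN. Qed.

Lemma kill_x_w : kill_x 'X_(w i) = 'X_(w i).
Proof. by rewrite killX /= (negPf (wNx i)) andbF. Qed.

(** The ideal generated by x is stable, so the action descends to the quotient. *)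
Lemma kill_x_shift c f : kill_x (shift c (kill_x f)) = kill_x (shift c f).
Proof.
elim/mpoly_gen_ind: f => [a|j|f g IHf IHg|f g IHf IHg].
- by rewrite killC shiftC killC.
- rewrite [kill_x 'X_j]killX /=; case: ifP => // /andP[ti /eqP->].
  by rewrite !rmorph0 shift_x kill_x_x ti.
- by rewrite !rmorphD IHf IHg.
- by rewrite !rmorphM IHf IHg.
Qed.

Lemma upoly_kill_x f : upoly i (kill_x f) = map_poly kill_x (upoly i f).
Proof.
elim/mpoly_gen_ind: f => [a|j|f g IHf IHg|f g IHf IHg].
- by rewrite killC upolyC map_polyC /= killC.
- have [->|ne] := eqVneq j (w i).
    by rewrite kill_x_w upolyX eqxx map_polyX.
  rewrite [upoly i 'X_j]upolyX (negPf ne) map_polyC /= killX.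
  by case: ifP => _; rewrite ?rmorph0 // upolyX (negPf ne).
- by rewrite !rmorphD /= IHf IHg.
- by rewrite !rmorphM /= IHf IHg.
Qed.

Lemma kill_x_eq0 f : kill_x f = 0 -> exists g, f = 'X_(x i) * g.
Proof.
move=> kf0; apply: mpolyX_dvd => m; rewrite lep1mP negbK => /eqP mx0.
have := congr1 (mcoeff m) kf0; rewrite mcoeff_kill mcoeff0; case: ifP => //.
by case/existsP => j /andP[/andP[_ /eqP->]]; rewrite mx0.
Qed.

Lemma transfer_mod_x e f : inv f -> f \is e.-homog for (bdeg blk i) ->
    (p.-1 <= e)%N -> (size (upoly i f) <= p)%N ->
  exists h q, f = transfer h + 'X_(x i) * q /\ inv q.
Proof.
move=> invf fhom le_pe szf; pose y : {mpoly F[n]} := 'X_(v i).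
pose u := map_poly kill_x (upoly i f); pose f0 := kill_x (upoly i f)`_0.
(* In the constant coefficient modulo x, the whole block degree [e] is carried by v. *)
have f0E m : f0@_m != 0 -> m (w i) = 0%N /\ (p.-1 <= m (v i))%N.
  rewrite mcoeff_kill coef_upoly mulm0n addm0; case: ifPn; first by rewrite eqxx.
  move=> /existsPn nx; have [mw0 fm|] := eqVneq (m (w i)) 0%N; last by rewrite eqxx.
  split=> //; have : bdeg blk i m = e.
    by apply: (dhomog_mf fhom); rewrite mcoeff_msupp.
  rewrite bdegE mw0; have := nx (x i); rewrite /= eqxx andbT.
  by case: (t i) => /= [|_]; [rewrite negbK => /eqP->|]; rewrite addn0 add0n => ->.
have [s f0s] : exists s, f0 = y ^+ p.-1 * s.
  rewrite mpolyXn; apply: mpolyX_dvd => m; apply: contraNeq => /f0E[_ mv].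
  apply/mnm_lepP => j; rewrite mulmnE mnm1E.
  by case: eqVneq => [<-|_]; rewrite ?mul1n.
(* The factor y^(p-1) of [f0] is removed beforehand: it is the denominator in Lagrange's formula. *)
pose h := s * (y ^+ p.-1 - 'X_(w i) ^+ p.-1); exists h.
have kws c : kill_x (wshift i c) = y *+ c.
  rewrite /wshift shift_w -[X in X - _]addrA [X in X - _]addrC addrK rmorphD rmorphMn /=.
  rewrite kill_x_v; case ti: (t i); last by rewrite rmorph0 addr0.
  by rewrite rmorphMn /= kill_x_x ti mul0rn addr0.
(* By invariance, the translate of the value [f0] of [u] at 0 is the value of [u] at - c y. *)
have uval c : kill_x (shift c f0) = u.[- (y *+ c)].
  rewrite kill_x_shift /u -{2}[f](inv_shift c invf) upoly_shift /ushift.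
  rewrite map_comp_poly horner_comp rmorphD /= map_polyX map_polyC /= kws.
  by rewrite hornerD hornerX hornerC addNr horner_coef0 !coef_map.
have uf0 c : map_poly kill_x (upoly i (shift c f0)) = (u.[- (y *+ c)])%:P.
  rewrite upoly_shift upoly_free => [|m mw]; last first.
    by apply: contraNeq mw => /f0E[->].
  by rewrite /ushift map_polyC /= comp_polyC map_polyC /= uval.
have y_neq0 : y != 0 by apply: mpolyX_neq0.
have chM : p \in [pchar {mpoly F[n]}] by rewrite pchar_lalg.
have szu : (size u <= p)%N by rewrite (leq_trans (size_poly _ _)).
have uh : map_poly kill_x (upoly i (transfer h)) = u.
  apply: (@mulfI _ (y ^+ p.-1)%:P); first by rewrite polyC_eq0 expf_neq0.
  rewrite [RHS]mul_polyC -(lagrange_pchar chM y_neq0 szu).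
  rewrite rmorph_sum [map_poly _ _]rmorph_sum mulr_sumr; apply: eq_bigr => c _ /=.
  have yc : map_poly kill_x (upoly i (shift c y)) = y%:P.
    rewrite shift_v !rmorphD /= upoly_v map_polyC /= kill_x_v.
    case ti: (t i); rewrite ?rmorph0 ?addr0 // rmorphMn /= upoly_x.
    by rewrite rmorphMn /= map_polyC /= kill_x_x ti polyC0 mul0rn addr0.
  have wc : map_poly kill_x (upoly i (shift c 'X_(w i))) = 'X + (y *+ c)%:P.
    have -> : shift c 'X_(w i) = 'X_(w i) + wshift i c by rewrite addrC subrK.
    rewrite rmorphD upolyX eqxx upoly_wshift rmorphD /= map_polyX map_polyC /=.
    by rewrite kws.
  rewrite /h rmorphM rmorphB !rmorphXn /= [upoly i _]rmorphM rmorphB !rmorphXn /=.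
  rewrite [map_poly _ _]rmorphM rmorphB !rmorphXn /= yc wc mulrA.
  congr (_ * _); rewrite -uf0 f0s rmorphM rmorphXn rmorphM rmorphXn.
  by rewrite [in RHS]rmorphM [in RHS]rmorphXn /= yc.
have [q fq] : exists q, f - transfer h = 'X_(x i) * q.
  apply: kill_x_eq0; apply/eqP; rewrite -(upolyK i (kill_x _)) upoly_kill_x.
  by rewrite rmorphB [map_poly _ _]rmorphB /= uh subrr horner0.
exists q; split; first by rewrite -fq addrC subrK.
apply: (@invMl 'X_(x i)); [exact: mpolyX_neq0|exact: shift_x|].
by rewrite -fq; apply: invB => //; apply: inv_transfer.
Qed.

End ModuloX.

Lemma block_decomposition i e f :
    inv f -> f \is e.-homog for (bdeg blk i) -> (p <= e)%N ->
  exists Q q h, [/\ f = orbit_norm i * Q + 'X_(x i) * q + transfer h, inv Q & inv q].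
Proof.
move=> invf fhom le_pe; have [Q [R [fE invQ invR szR]]] := norm_division i invf.
pose pi d (g : {mpoly F[n]}) := pihomog (bdeg blk i) d g.
have Nhom : orbit_norm i \is p.-homog for (bdeg blk i).
  have -> : p = (\sum_(c < p) 1)%N by rewrite sum1_card card_ord.
  apply: (big_ind2 (fun g d => g \is d.-homog for (bdeg blk i))).
  - exact: dhomog1.
  - by move=> g1 d1 g2 d2; apply: dhomogM.
  - by move=> c _; have := shift_bhomog i c (w i); rewrite blkw eqxx.
(* Passing to components of block degree makes the remainder homogeneous, as [transfer_mod_x]
   requires. *)
have {}fE : f = orbit_norm i * pi (e - p)%N Q + pi e R.
  by rewrite -[LHS](pihomog_dE fhom) fE pihomogD mulrC (pihomogM _ _ Nhom) le_pe.
have [||||h [q [piR invq]]] := @transfer_mod_x i e (pi e R).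
- exact: inv_pibhomog.
- exact: pihomogP.
- by rewrite (leq_trans (leq_pred _)).
- apply/leq_sizeP => j le_pj; apply/mpolyP => m; rewrite coef_upoly mcoeff_pihomog mcoeff0.
  case: eqVneq => // mw; case: ifP => // _.
  have := coef_upoly i R j m; rewrite mw eqxx => <-.
  by move/leq_sizeP: szR => /(_ j le_pj)->; rewrite mcoeff0.
exists (pi (e - p)%N Q), q, h; split=> //; last exact: inv_pibhomog.
by rewrite fE piR -!addrA [transfer h + _]addrC.
Qed.

(** * Generation in degree at most k (p - 1) + 1, by induction on the degree *)

Hypothesis k_gt2 : (2 < k)%N.

Definition low_inv d f := inv f /\ exists2 e, (e <= d)%N & f \is e.-homog.

Section UpperBound.

Let D := (k * (p - 1) + 1)%N.
Let alg := subalg_gen (low_inv D).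

Let alg0 : alg 0.
Proof. by rewrite -mpolyC0; apply: subalg_gen_cst. Qed.

Let alg_sum (I : Type) (r : seq I) (P : pred I) (a : I -> {mpoly F[n]}) :
  (forall j, P j -> alg (a j)) -> alg (\sum_(j <- r | P j) a j).
Proof. by move=> ha; elim/big_ind: _ => //; apply: subalg_gen_add. Qed.

Let ltpD : (p <= D)%N.
Proof. by rewrite /D; nia. Qed.

Section Step.

Variable d : nat.
Hypothesis lt_Dd : (D < d)%N.
Hypothesis IHd : forall e f, (e < d)%N -> inv f -> alg (pihomog mdeg e f).

(** Both factors of the component have degree below [d]: e <= p <= D < d, and d - e < d because e >
    0. *)
Lemma alg_pihomog_mul e f g : inv f -> f \is e.-homog -> (0 < e <= p)%N ->
  inv g -> alg (pihomog mdeg d (f * g)).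
Proof.
move=> invf fhom /andP[e_gt0 le_ep] invg; rewrite (pihomogM _ _ fhom).
case: ifP => // le_ed; apply: subalg_gen_mul.
  rewrite -(pihomog_dE fhom); apply: IHd => //.
  by rewrite (leq_ltn_trans le_ep) // (leq_ltn_trans ltpD).
by apply: IHd => //; lia.
Qed.

Lemma alg_transfer_hilbert h :
  hilbert_ideal h -> alg (pihomog mdeg d (transfer h)).
Proof.
elim=> [e g h' invg ghom lte|f g _ algf _ algg].
  rewrite transferMl //; apply: (alg_pihomog_mul _ ghom) => //.
  exact: inv_transfer.
by rewrite transferD pihomogD; apply: subalg_gen_add.
Qed.

(** The component of a transfer is the transfer of a form of degree [d] > D, all of whose monomials
    lie in the Hilbert ideal. *)
Lemma alg_transfer h : alg (pihomog mdeg d (transfer h)).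
Proof.
rewrite -(pihomog_id mdeg) pihomog_transfer; apply: alg_transfer_hilbert.
rewrite pihomogE; apply: hilbert_sum => m /eqP dm.
by rewrite -mul_mpolyC mulrC; apply/hilbertM/hilbert_monomial; rewrite dm.
Qed.

Lemma alg_block i e f : inv f -> f \is e.-homog for (bdeg blk i) -> (p <= e)%N ->
  alg (pihomog mdeg d f).
Proof.
move=> invf fhom le_pe.
have [Q [q [h [-> invQ invq]]]] := block_decomposition invf fhom le_pe.
have p_gt0 : (0 < p)%N by rewrite ltnW // ltnW.
rewrite !pihomogD; do 2?apply: subalg_gen_add; last exact: alg_transfer.
  by apply: (alg_pihomog_mul _ (norm_homog i)) => //; [apply: inv_norm|rewrite p_gt0 leqnn].
apply: (@alg_pihomog_mul 1) => //; [exact: shift_x | by rewrite dhomogX /= mdeg1].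
Qed.

(** Induction on the list [s] of blocks whose degree may still reach [p]. With [s] empty, no
    monomial has degree above k (p - 1). *)
Lemma alg_split (s : seq 'I_k) f : inv f ->
    (forall m i, i \notin s -> m \in msupp f -> (bdeg blk i m < p)%N) ->
  alg (pihomog mdeg d f).
Proof.
elim: s f => [|i s IHs] f invf small.
  rewrite (_ : pihomog mdeg d f = 0) //; apply/mpolyP => m.
  rewrite mcoeff_pihomog mcoeff0; case: eqVneq => // /= dm; apply/eqP.
  rewrite mcoeff_eq0; apply/negP => fm.
  suff: (mdeg m <= k * (p - 1))%N by rewrite dm; move: lt_Dd; rewrite /D; lia.
  rewrite mdeg_bdeg -[X in (_ <= X * _)%N]card_ord -sum_nat_const.
  by apply: leq_sum => i _; have := small m i isT fm; lia.
(* With [b] at least [p] the sum can be cut at [p]: the upper part falls to [alg_block], the lower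
   part to the induction. *)
pose b := maxn p (mmeasure (bdeg blk i) f).
have fE : f = \sum_(e < b) pihomog (bdeg blk i) e f.
  by apply: pihomog_partitionE; rewrite leq_maxr.
rewrite fE -(big_mkord xpredT (fun e => pihomog (bdeg blk i) e f)).
rewrite (big_cat_nat (leq0n p)) ?leq_maxl //= pihomogD.
apply: subalg_gen_add; last first.
  rewrite big_nat linear_sum; apply: alg_sum => e /andP[le_pe _].
  by apply: (@alg_block i e) => //; [apply: inv_pibhomog | apply: pihomogP].
apply: IHs.
  by rewrite /inv rmorph_sum; apply: eq_bigr => e _; apply: inv_pibhomog.
move=> m j js; rewrite big_mkord mcoeff_msupp raddf_sum /=.
have [->|ne] := eqVneq j i.
  rewrite ltnNge; apply: contra => ltm.
  by apply/eqP/big1 => e _; rewrite mcoeff_pihomog /= gtn_eqF // (leq_trans (ltn_ord e)).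
move=> fm; apply: small; first by rewrite inE negb_or ne.
rewrite mcoeff_msupp; apply: contraNneq fm => fm0.
by rewrite big1 // => e _; rewrite mcoeff_pihomog fm0 if_same.
Qed.

End Step.

Lemma low_inv_generate f : inv f -> alg f.
Proof.
move=> invf.
have alg_hom d g : inv g -> alg (pihomog mdeg d g).
  elim/ltn_ind: d g => d IHd g invg; have [le_dD|lt_Dd] := leqP d D.
    apply: subalg_gen_in; split; first exact: inv_pihomog.
    by exists d => //; apply: pihomogP.
  apply: (@alg_split d lt_Dd _ (enum 'I_k)) => // [e h lt_ed invh|m i].
    exact: IHd.
  by rewrite mem_enum.
rewrite (pihomog_partitionE (leqnn (mmeasure mdeg f))).
by apply: alg_sum => e _; apply: alg_hom.
Qed.

End UpperBound.

Lemma low_inv_sound d f : subalg_gen (low_inv d) f -> inv f.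
Proof.
by elim=> [g []|c|g h _ ? _ ?|g h _ ? _ ?] //;
  [apply: shiftC | apply: invD | apply: invM].
Qed.

(** * Lower bound *)

Section CoefficientRelation.

Definition kill_xs := kill F [pred j | t (blk j) && (j == x (blk j))].

Lemma kill_xs_x i : kill_xs 'X_(x i) = if t i then 0 else 'X_(x i).
Proof. by rewrite killX /= blkx eqxx andbT. Qed.

Lemma kill_xs_v i : kill_xs 'X_(v i) = 'X_(v i).
Proof. by rewrite killX /= blkv eq_sym xv andbN. Qed.

Lemma kill_xs_w i : kill_xs 'X_(w i) = 'X_(w i).
Proof. by rewrite killX /= blkw (negPf (wNx i)) andbF. Qed.

Definition x_free m := forall i, t i -> m (x i) = 0%N.

Lemma mcoeff_kill_xs f m : x_free m -> (kill_xs f)@_m = f@_m.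
Proof.
move=> mfree; rewrite mcoeff_kill; case: ifP => // /existsP[j /andP[/andP[tj /eqP ->]]].
by rewrite mfree.
Qed.

(** Modulo the x's of the V_3 blocks, s^c is w -> w + c v; here c becomes an indeterminate. The
    coefficient of degree 1 is then the derivation of v d/dw. *)
Definition taylor : {rmorphism {mpoly F[n]} -> {poly {mpoly F[n]}}} :=
  s2val (mpoly_subst (polyC \o @mpolyC n F)
    (fun j => if j == w (blk j) then ('X_j)%:P + ('X_(v (blk j)))%:P * 'X
              else (kill_xs 'X_j)%:P)).

Lemma taylorC c : taylor c%:MP = (c%:MP)%:P.
Proof. by rewrite /taylor; case: mpoly_subst. Qed.

Lemma taylor_w i : taylor 'X_(w i) = ('X_(w i))%:P + ('X_(v i))%:P * 'X.
Proof. by rewrite /taylor; case: mpoly_subst => u _ /= ->; rewrite blkw eqxx. Qed.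

Lemma taylor_neq j : j != w (blk j) -> taylor 'X_j = (kill_xs 'X_j)%:P.
Proof. by rewrite /taylor; case: mpoly_subst => u _ /= -> /negPf ->. Qed.

Lemma taylor_v i : taylor 'X_(v i) = ('X_(v i))%:P.
Proof. by rewrite taylor_neq ?kill_xs_v // vNw. Qed.

Lemma taylor_x i : taylor 'X_(x i) = (kill_xs 'X_(x i))%:P.
Proof. by rewrite taylor_neq // xNw. Qed.

Lemma horner_taylor c f : (taylor f).[(c%:R)%:MP] = kill_xs (shift c f).
Proof.
elim/mpoly_gen_ind: f => [a||f g IHf IHg|f g IHf IHg].
- by rewrite shiftC killC taylorC hornerC.
- apply: var_ind => i; rewrite shiftE ?rmorphD ?rmorphMn /=.
  + rewrite taylor_w hornerD hornerM hornerX !hornerC kill_xs_w kill_xs_v mpolyC1 mulr_natr.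
    by case ti: (t i); rewrite ?rmorph0 ?rmorphMn /= ?kill_xs_x ?ti ?mul0rn addr0.
  + rewrite taylor_v hornerC kill_xs_v.
    by case ti: (t i); rewrite ?rmorph0 ?rmorphMn /= ?kill_xs_x ?ti ?mul0rn addr0.
  + by rewrite taylor_x hornerC.
- by rewrite !rmorphD hornerD IHf IHg.
- by rewrite !rmorphM hornerM IHf IHg.
Qed.

Lemma taylor_coef0 f : (taylor f)`_0 = kill_xs f.
Proof.
rewrite -horner_coef0 -[f in RHS](@shift0p 0) // -horner_taylor.
by rewrite mulr0n mpolyC0.
Qed.

(** Both sides satisfy the Leibniz rule over [kill_xs], so they need only agree on the variables. *)
Lemma taylor_coef1 f :
  (taylor f)`_1 = kill_xs (\sum_i 'X_(v i) * f^`M(w i)).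
Proof.
elim/mpoly_gen_ind: f => [a||f g IHf IHg|f g IHf IHg].
- rewrite taylorC coefC /= big1 ?rmorph0 // => i _.
  by rewrite mderivC mulr0.
- apply: var_ind => j.
  + rewrite taylor_w coefD coefC coefCM coefX /= add0r mulr1 (bigD1 j) //= big1.
      by rewrite addr0 mderivXU eqxx mulr1 kill_xs_v.
    by move=> i ne; rewrite mderivXU (can_eq blkw) eq_sym (negPf ne) mulr0.
  + rewrite taylor_v coefC /= big1 ?rmorph0 // => i _.
    by rewrite mderivXU (negPf (vNw _ _)) mulr0.
  + rewrite taylor_x coefC /= big1 ?rmorph0 // => i _.
    by rewrite mderivXU (negPf (xNw _ _)) mulr0.
- rewrite rmorphD coefD IHf IHg -rmorphD -big_split; congr (kill_xs _).
  by apply: eq_bigr => i _; rewrite mderivD mulrDr.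
- rewrite rmorphM coefM 2!big_ord_recl big_ord0 addr0 /= !taylor_coef0 IHf IHg.
  rewrite -!rmorphM -rmorphD; congr (kill_xs _).
  rewrite mulr_suml mulr_sumr -big_split; apply: eq_bigr => i _.
  by rewrite mderivM /=; ring.
Qed.

Definition vdeg m := (\sum_i m (v i))%N.

Lemma vdegD m1 m2 : vdeg (m1 + m2)%MM = (vdeg m1 + vdeg m2)%N.
Proof. by rewrite -big_split; apply: eq_bigr => i _; rewrite mnmDE. Qed.

(** Each power of the indeterminate comes with a factor v. *)
Lemma taylor_coef_small f j m : (vdeg m < j)%N -> (taylor f)`_j@_m = 0.
Proof.
have smallC (c : {mpoly F[n]}) j' m' : (vdeg m' < j')%N -> c%:P`_j'@_m' = 0.
  by rewrite coefC; case: j' => // j' _; rewrite mcoeff0.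
elim/mpoly_gen_ind: f j m => [a|i|f g IHf IHg|f g IHf IHg] j m.
- by rewrite taylorC; apply: smallC.
- elim/var_ind: i j m => i j m.
  + move=> lt; rewrite taylor_w coefD mcoeffD smallC // add0r coefCM coefX.
    case: j lt => [//|[|j]] lt; last by rewrite mulr0 mcoeff0.
    rewrite mulr1 mcoeffX; case: eqVneq => // mE; move: lt.
    by rewrite -mE /vdeg (bigD1 i) //= mnm1E eqxx.
  + by rewrite taylor_v; apply: smallC.
  + by rewrite taylor_x; apply: smallC.
- by move=> lt; rewrite rmorphD coefD mcoeffD IHf // IHg // addr0.
move=> lt; rewrite rmorphM coefM raddf_sum; apply: big1 => l _ /=.
rewrite mcoeffM; apply: big1 => -[m1 m2] /eqP /= mE.
have [lt1|le1] := ltnP (vdeg m1) l; first by rewrite IHf ?mul0r.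
rewrite [X in _ * X]IHg ?mulr0 //; have := congr1 vdeg mE; rewrite vdegD.
by have := ltn_ord l; lia.
Qed.

(* On monomials of degree < p in the v's, the polynomial c |-> coefficient of
   shift c g has degree < p, so being constant on F_p it is constant. *)
Lemma taylor_coef1_inv g m : inv g -> (vdeg m < p)%N -> (taylor g)`_1@_m = 0.
Proof.
move=> invg ltm; have p_gt1 := prime_gt1 (pcharf_prime chFp).
pose P := map_poly (mcoeff m) (taylor g).
have Pval c : P.[c%:R] = (kill_xs g)@_m.
  rewrite -[g in RHS](inv_shift c invg) -horner_taylor (horner_coef (taylor g)).
  rewrite (horner_coef_wide _ (size_poly _ _)) raddf_sum; apply: eq_bigr => j _.
  by rewrite coef_map -(rmorphXn (@mpolyC n F)) /= mulrC -mcoeffCM mulrC.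
pose Q := P - ((kill_xs g)@_m)%:P.
have szQ : (size Q <= p)%N.
  apply/leq_sizeP => j le_pj; rewrite coefD coefN coefC coef_map /=.
  rewrite taylor_coef_small ?(leq_trans ltm) //; case: j le_pj => [|j _]; last by rewrite subr0.
  by rewrite leqn0 => /eqP p0; rewrite p0 in p_gt1.
have Q0 : Q = 0.
  apply/eqP/idPn => Q_neq0; pose rs := [seq c%:R : F | c <- iota 0 p].
  have : (size rs < size Q)%N.
    apply: max_poly_roots => //.
      by apply/allP => _ /mapP[c _ ->]; rewrite /root hornerD hornerN hornerC Pval subrr.
    rewrite map_inj_in_uniq ?iota_uniq // => c d; rewrite !mem_iota !add0n /= => ltc ltd.
    by move/eqP; rewrite (mulrn_inj_lt_pchar chFp) ?oner_neq0 // => /eqP.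
  by rewrite size_map size_iota ltnNge szQ.
have /(congr1 (fun q : {poly F} => q`_1)) := Q0.
by rewrite coefD coefN coefC coef_map coef0 /= subr0.
Qed.

(** This reads off the coefficient of [m] in the derivation of [g]; the factor [(m (w i)).+1] comes
    from d/dw. *)
Lemma inv_coef_relation g m : inv g -> (vdeg m < p)%N -> x_free m ->
  \sum_i (if (0 < m (v i))%N
          then g@_(m - U_(v i) + U_(w i))%MM *+ (m (w i)).+1 else 0) = 0.
Proof.
move=> invg ltm mfree; rewrite -[RHS](taylor_coef1_inv invg ltm) taylor_coef1.
rewrite mcoeff_kill_xs // raddf_sum; apply: eq_bigr => i _ /=.
rewrite mcoeffXM lep1mP -lt0n; case: ifP => // mv.
by rewrite mcoeff_deriv mnmBE mnm1E (negPf (vNw _ _)) subn0.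
Qed.

(** Testing only [w] and [v] suits both types: [x i] gets exponent [a i] where it is [v i], and 0
    otherwise. *)
Definition mon (a b : 'I_k -> nat) : 'X_{1..n} :=
  [multinom if j == w (blk j) then b (blk j)
            else if j == v (blk j) then a (blk j) else 0 | j < n].

Lemma mon_w a b i : mon a b (w i) = b i.
Proof. by rewrite mnmE blkw eqxx. Qed.

Lemma mon_v a b i : mon a b (v i) = a i.
Proof. by rewrite mnmE blkv eqxx (negPf (vNw _ _)). Qed.

Lemma mon_x a b : x_free (mon a b).
Proof.
by move=> i ti; rewrite mnmE blkx (negPf (xNw _ _)) xv ti.
Qed.

Lemma monP a b m : (forall i, m (v i) = a i) -> (forall i, m (w i) = b i) ->
  x_free m -> m = mon a b.
Proof.
move=> mv mw mx; apply/mnmP; apply: var_ind => i; rewrite ?mon_v ?mon_w //.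
case ti: (t i); first by rewrite mon_x ?mx.
have -> : x i = v i by apply/eqP; rewrite xv ti.
by rewrite mon_v.
Qed.

Variables (g : {mpoly F[n]}) (delta : 'I_k -> nat) (i0 : 'I_k).
Hypotheses (invg : inv g) (delta_lt : forall i, (delta i < p)%N).
Hypothesis delta0_lt : (delta i0 < p.-1)%N.
Hypothesis delta_sum : (delta i0 < \sum_(i | i != i0) delta i)%N.

(** The total exponent [delta i] of v and w is fixed in each block, and [a i] is the share of v. The
    aim is that [gamma a0] vanishes. *)
Let gamma (a : 'I_k -> nat) := g@_(mon a (fun i => (delta i - a i)%N)).
Let dec (a : 'I_k -> nat) i j := (a j - (j == i))%N.
Let binom (a : 'I_k -> nat) := (\prod_(i | i != i0) 'C(delta i, a i))%N.
Let a0 i := if i == i0 then delta i0 else 0%N.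

Let eq_gamma a b : a =1 b -> gamma a = gamma b.
Proof.
move=> eq_ab; congr (g@_ _); apply: monP => [i|i|]; last exact: mon_x.
  by rewrite mon_v.
by rewrite mon_w eq_ab.
Qed.

Let gamma_relation a : (forall i, (a i <= delta i)%N) -> (\sum_i a i < p)%N ->
  \sum_i (if (0 < a i)%N then gamma (dec a i) *+ (delta i - a i).+1 else 0) = 0.
Proof.
move=> le_ad lta; pose m := mon a (fun i => (delta i - a i)%N).
have vm : (vdeg m < p)%N by rewrite /vdeg; under eq_bigr => i _ do rewrite mon_v.
rewrite -[RHS](inv_coef_relation invg vm (@mon_x _ _)); apply: eq_bigr => i _.
rewrite mon_v mon_w; case: ifP => // ai; congr (g@_ _ *+ _).
apply/esym/monP => [j|j|j tj]; rewrite mnmDE mnmBE !mnm1E ?mon_v ?mon_w ?(mon_x _ _ tj).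
- by rewrite (can_eq blkv) [w i == _]eq_sym (negPf (vNw _ _)) addn0 eq_sym.
- rewrite (negPf (vNw _ _)) (can_eq blkw) subn0 /dec eq_sym.
  by have := le_ad j; case: eqVneq => [->|_] /=; lia.
- by rewrite [w i == _]eq_sym (negPf (xNw _ _)) addn0.
Qed.

Let binom_dec a i : i != i0 -> (0 < a i)%N -> (a i <= delta i)%N ->
  (binom (dec a i) * (delta i - a i).+1 = binom a * a i)%N.
Proof.
move=> ne ai le_ad; rewrite /binom (bigD1 i) //= [in RHS](bigD1 i) //= /dec eqxx.
rewrite (eq_bigr (fun j => 'C(delta j, a j))) => [|j /andP[_ /negPf ->]]; last first.
  by rewrite subn0.
rewrite mulnAC [in RHS]mulnAC; congr (_ * _)%N.
case: (a i) ai le_ad => // b _ lt; rewrite subn1 /= subnSK // mulnC.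
by rewrite -mul_bin_left mulnC.
Qed.

Let sum_dec a i : (0 < a i)%N -> (\sum_j dec a i j + 1 = \sum_j a j)%N.
Proof.
move=> ai; rewrite (bigD1 i) //= [RHS](bigD1 i) //= {1}/dec eqxx addnAC subnK //.
by congr addn; apply: eq_bigr => j /negPf ne; rewrite /dec ne subn0.
Qed.

Let partial_sum c a : (forall i, (a i <= delta i)%N) ->
    (forall i, i != i0 -> (0 < a i)%N -> gamma (dec a i) = (binom (dec a i))%:R * c) ->
  \sum_(i | i != i0) (if (0 < a i)%N then gamma (dec a i) *+ (delta i - a i).+1 else 0)
    = (binom a * \sum_(i | i != i0) a i)%:R * c.
Proof.
move=> le_ad IH; rewrite big_distrr natr_sum mulr_suml; apply: eq_bigr => i ne /=.
case: ifPn => [ai|]; last by rewrite -eqn0Ngt => /eqP->; rewrite muln0 mul0r.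
by rewrite IH // -binom_dec // natrM mulrAC mulr_natr.
Qed.

(** Among vectors of sum [delta i0], the relations determine [gamma] from [gamma a0]. Here [j] is
    the weight moved away from [i0], and signed products of binomials solve the recursion. *)
Let gamma_spread j : (j <= delta i0)%N -> forall a, (forall i, (a i <= delta i)%N) ->
    a i0 = (delta i0 - j)%N -> (\sum_i a i = delta i0)%N ->
  gamma a = (binom a)%:R * ((-1) ^+ j * gamma a0).
Proof.
elim: j => [|j IHj] le_jd a le_ad a_i0 sum_a.
  have a_eq0 i : i != i0 -> a i = 0%N.
    move=> ne; have : (\sum_(i | i != i0) a i = 0)%N.
      by move: sum_a; rewrite (bigD1 i0) //= a_i0 subn0; lia.
    by move/eqP; rewrite sum_nat_eq0 => /forallP/(_ i); rewrite ne => /eqP.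
  rewrite /binom big1 => [|i /a_eq0->]; last by rewrite bin0.
  rewrite expr0 !mul1r; apply: eq_gamma => i; rewrite /a0.
  by case: eqVneq => [->|/a_eq0//]; rewrite a_i0 subn0.
(* The relation at [a'] expresses (j + 1) [gamma a] through terms with one unit more at [i0], known
   by induction; j + 1 is invertible since it is below [p]. *)
pose a' i := (a i + (i == i0))%N.
have a'_i0 : a' i0 = (delta i0 - j)%N by rewrite /a' eqxx a_i0; lia.
have a'_neq i : i != i0 -> a' i = a i by rewrite /a' => /negPf ->; rewrite addn0.
have le_a'd i : (a' i <= delta i)%N.
  by have [->|/a'_neq->] := eqVneq i i0; rewrite ?a'_i0 ?leq_subr.
have sum_neq : (\sum_(i | i != i0) a i = j.+1)%N.
  by move: sum_a; rewrite (bigD1 i0) //= a_i0; lia.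
have sum_neq' : (\sum_(i | i != i0) a' i = j.+1)%N by rewrite -sum_neq; apply: eq_bigr.
have binom_a' : binom a' = binom a by apply: eq_bigr => i /a'_neq->.
have sum_a' : (\sum_i a' i = (delta i0).+1)%N.
  by rewrite (bigD1 i0) //= sum_neq' a'_i0; lia.
have lt_a' : (\sum_i a' i < p)%N by rewrite sum_a'; lia.
have := gamma_relation le_a'd lt_a'; rewrite (bigD1 i0) //= a'_i0.
rewrite (partial_sum (c := (-1) ^+ j * gamma a0)) // => [|i ne a'i]; last first.
  apply: IHj => [|i'||]; rewrite ?(ltnW le_jd) //.
  - by rewrite (leq_trans (leq_subr _ _)).
  - by rewrite /dec [i0 == i]eq_sym (negPf ne) subn0.
  by have := sum_dec a'i; rewrite sum_a' addn1 => -[].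
rewrite ifT; last by lia.
rewrite (@eq_gamma _ a) => [|i]; last by rewrite /dec addnK.
rewrite subKn ?(ltnW le_jd) // sum_neq' binom_a' natrM -mulr_natl.
have jN0 : (j.+1%:R : F) != 0.
  by rewrite -(dvdn_pcharf chFp) gtnNdvd //; lia.
move=> eq0; apply: (mulfI jN0); apply/eqP; rewrite -subr_eq0; apply/eqP.
by rewrite -[RHS]eq0 exprS; ring.
Qed.

Let sub_weight s (d : 'I_k -> nat) : (s <= \sum_i d i)%N ->
  exists a : 'I_k -> nat, (forall i, (a i <= d i)%N) /\ (\sum_i a i = s)%N.
Proof.
elim: s => [_|s IHs lt_sd]; first by exists (fun=> 0%N); rewrite big1.
have [a [le_ad sum_a]] := IHs (ltnW lt_sd).
have [i lt_i] : exists i, (a i < d i)%N.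
  apply/existsP; apply: contraLR lt_sd => /existsPn ge_ad.
  by rewrite -leqNgt -sum_a; apply: leq_sum => i _; have := ge_ad i; rewrite -leqNgt.
exists (fun j => a j + (j == i))%N; split=> [j|].
  by case: eqVneq => [->|_]; rewrite ?addn1 ?addn0.
by rewrite big_split /= sum_a (bigD1 i) //= eqxx big1 ?addn0 ?addn1 // => j /negPf->.
Qed.

Lemma inv_coef_eq0 :
  g@_(mon (fun i => if i == i0 then delta i0 else 0%N)
          (fun i => if i == i0 then 0%N else delta i)) = 0.
Proof.
rewrite (_ : mon _ _ = mon a0 (fun i => (delta i - a0 i)%N)); last first.
  apply: monP => [i|i|]; rewrite ?mon_v ?mon_w //; last exact: mon_x.
  by rewrite /a0; case: eqVneq => [->|_]; rewrite ?subnn ?subn0.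
rewrite -/(gamma a0).
(* A vector of sum [delta i0] + 1 that is 0 at [i0]: its relation has no term at [i0], and the
   others add up to a multiple of [gamma a0]. *)
have [|a [le_ad sum_a]] := @sub_weight (delta i0).+1 (fun i => if i == i0 then 0%N else delta i).
  by rewrite (bigD1 i0) //= eqxx add0n (eq_bigr delta) // => i /negPf->.
have a_i0 : a i0 = 0%N by have := le_ad i0; rewrite eqxx leqn0 => /eqP.
have {}le_ad i : (a i <= delta i)%N by apply: leq_trans (le_ad i) _; case: ifP.
have lt_ap : (\sum_i a i < p)%N by rewrite sum_a; lia.
have := gamma_relation le_ad lt_ap; rewrite (bigD1 i0) //= a_i0 add0r.
rewrite (partial_sum (c := (-1) ^+ delta i0 * gamma a0)) // => [|i ne ai]; last first.
  apply: gamma_spread => // [i'||].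
  - by rewrite (leq_trans (leq_subr _ _)).
  - by rewrite /dec a_i0 subnn.
  by have := sum_dec ai; rewrite sum_a addn1 => -[].
have -> : (\sum_(i | i != i0) a i = (delta i0).+1)%N.
  by rewrite -sum_a [RHS](bigD1 i0) //= a_i0.
move/eqP; rewrite natrM !mulf_eq0 expf_eq0 oppr_eq0 oner_eq0 andbF /=.
case/orP => [|/eqP //]; rewrite -!(dvdn_pcharf chFp) [(_ %| _.+1)%N]gtnNdvd ?orbF //; last first.
  by lia.
have p_pr := pcharf_prime chFp.
(* The binomial C(delta i, a i) divides (delta i)!, which is prime to [p] as delta i < p. *)
rewrite /binom => dv; exfalso; move: dv; apply/negP.
elim/big_ind: _ => [|c d Nc Nd|i _].
- by rewrite gtnNdvd // prime_gt1.
- by rewrite Euclid_dvdM // negb_or Nc.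
have : ~~ (p %| (delta i)`!)%N.
  have := delta_lt i; elim: (delta i) => [|d IHd] ltd.
    by rewrite gtnNdvd // prime_gt1.
  by rewrite factS Euclid_dvdM // negb_or IHd ?(ltnW ltd) // gtnNdvd.
by apply: contra => dv; rewrite -(bin_fact (le_ad i)) dvdn_mulr.
Qed.

End CoefficientRelation.

(** * The monomial [top] and the degree of generators *)

Section LowerBound.

Variable i0 : 'I_k.

Let top := mon (fun i => if i == i0 then p.-1 else 0%N)
               (fun i => if i == i0 then 0%N else p.-1).

Let p_gt1 : (1 < p)%N. Proof. exact: ltnW. Qed.

Let mdeg_top : mdeg top = (k * (p - 1))%N.
Proof.
rewrite mdeg_bdeg -[k in RHS]card_ord -sum_nat_const; apply: eq_bigr => i _.
rewrite bdegE mon_w mon_v subn1.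
have -> : (if t i then top (x i) else 0%N) = 0%N by case: ifP => // /mon_x->.
by case: eqVneq; rewrite ?addn0.
Qed.

Let le_topP m : (m <= top)%MM -> x_free m.
Proof.
move=> /mnm_lepP le i ti; apply/eqP; rewrite -leqn0.
by rewrite (leq_trans (le _)) // mon_x.
Qed.

(** A divisor of [top] has at most one variable in each block; this is its exponent. *)
Let dpart m i := if i == i0 then m (v i0) else m (w i).

Let dpart_mon m : (m <= top)%MM ->
  m = mon (fun i => if i == i0 then dpart m i0 else 0%N)
          (fun i => if i == i0 then 0%N else dpart m i).
Proof.
move=> le_m; apply: monP => [i|i|]; last exact: le_topP; move/mnm_lepP: le_m.
  move/(_ (v i)); rewrite mon_v /dpart eqxx; case: eqVneq => [->//|_].
  by rewrite leqn0 => /eqP.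
move/(_ (w i)); rewrite mon_w /dpart; case: eqVneq => [->|//].
by rewrite leqn0 => /eqP.
Qed.

Let inv_coef_dpart g m : inv g -> (m <= top)%MM -> (dpart m i0 < p.-1)%N ->
  (dpart m i0 < \sum_(i | i != i0) dpart m i)%N -> g@_m = 0.
Proof.
move=> invg le_m lt0 lts; rewrite (dpart_mon le_m).
apply: (inv_coef_eq0 invg _ lt0 lts) => i.
rewrite /dpart; move/mnm_lepP: le_m => le_m; case: eqVneq => [_|ne].
  by have := le_m (v i0); rewrite mon_v eqxx; lia.
by have := le_m (w i); rewrite mon_w (negPf ne); lia.
Qed.

(* If m1 + m2 = top, the v-degrees of m1 and m2 add up to p - 1 and their
   w-degrees to (k - 1)(p - 1) > p - 1, so one of them has the larger w-degree. *)
Lemma inv_mul_coef_top f g : inv f -> inv g -> f@_top = 0 -> g@_top = 0 ->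
  (f * g)@_top = 0.
Proof.
move=> invf invg f0 g0; rewrite mcoeffM; apply: big1 => -[[m1 ?] [m2 ?]] /= /eqP topE.
have le1 : (m1 <= top)%MM by rewrite topE lem_addr.
have le2 : (m2 <= top)%MM by rewrite topE lem_addl.
have [m10|m1N0] := eqVneq m1 0%MM.
  by move: topE; rewrite m10 add0m => <-; rewrite g0 mulr0.
have [m20|m2N0] := eqVneq m2 0%MM.
  by move: topE; rewrite m20 addm0 => <-; rewrite f0 mul0r.
have dD i : (dpart m1 i + dpart m2 i = p.-1)%N.
  rewrite /dpart; case: eqVneq => [_|ne]; rewrite -mnmDE -topE.
    by rewrite mon_v eqxx.
  by rewrite mon_w (negPf ne).
pose s m := (\sum_(i | i != i0) dpart m i)%N.
have sD : (s m1 + s m2 = (k - 1) * p.-1)%N.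
  rewrite /s -big_split (eq_bigr (fun=> p.-1)) => [|i _]; last exact: dD.
  by rewrite sum_nat_const cardC1 card_ord subn1.
have sN0 m : (m <= top)%MM -> m != 0%MM -> (0 < dpart m i0 + s m)%N.
  move=> le_m; apply: contraNltn; rewrite leqn0 addn_eq0 => /andP[/eqP d0].
  rewrite /s sum_nat_eq0 => /forallP s0; apply/eqP; rewrite (dpart_mon le_m).
  apply/esym/monP => [i|i|i _]; rewrite mnm0E ?d0 ?if_same //.
  by have := s0 i; case: eqVneq => //= _ /eqP.
have := sN0 _ le1 m1N0; have := sN0 _ le2 m2N0; have := dD i0 => dD0 gt1 gt2.
have two : (2 * p.-1 <= s m1 + s m2)%N by rewrite sD leq_mul2r; lia.
have [/andP[lt1 lt1']|] := boolP ((dpart m1 i0 < p.-1) && (dpart m1 i0 < s m1))%N.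
  by rewrite (inv_coef_dpart invf) ?mul0r.
have [/andP[lt2 lt2']|] := boolP ((dpart m2 i0 < p.-1) && (dpart m2 i0 < s m2))%N.
  by rewrite (inv_coef_dpart invg) ?mulr0.
(* Otherwise either one factor takes all of p - 1 at [i0] and the other is trivial, or s m1 + s m2
   <= p - 1, against [two]. *)
rewrite !negb_and -!leqNgt => c1 c2; exfalso.
by move: p_gt1 c1 c2 => ? /orP[] ? /orP[] ?; lia.
Qed.

Let top_transfer : (transfer (\prod_i 'X_(w i) ^+ p.-1))@_top = -1.
Proof.
(* Variables absent from [top] may be set to 0; then s^c w_i becomes c v_i at [i0] and w_i
   elsewhere. *)
pose K := kill F [pred j | top j == 0%N].
have topK f : f@_top = (K f)@_top.
  by rewrite mcoeff_kill; case: ifP => // /existsP[j /= /andP[->]].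
have Kx i : K ('X_(x i) *+ (t i)) = 0.
  case ti: (t i); rewrite ?rmorph0 // mulr1n killX /= ifT //.
  by rewrite mon_x.
have topE : 'X_[top] = 'X_(v i0) ^+ p.-1 * \prod_(i | i != i0) 'X_(w i) ^+ p.-1
    :> {mpoly F[n]}.
  rewrite mpolyXn (eq_bigr (fun i => 'X_[U_(w i) *+ p.-1])) => [|i _]; last by rewrite mpolyXn.
  rewrite mprodXE -mpolyXD; congr 'X_[_]; apply/esym/monP => [i|i|i ti].
  - rewrite mnmDE mulmnE mnm1E (can_eq blkv) mnm_sumE big1 ?addn0.
      by rewrite eq_sym; case: eqVneq; rewrite ?mul1n.
    by move=> j _; rewrite mulmnE mnm1E eq_sym (negPf (vNw _ _)).
  - rewrite mnmDE mulmnE mnm1E (negPf (vNw _ _)) mul0n add0n mnm_sumE.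
    case: eqVneq => [->|ne].
      by rewrite big1 // => j ne; rewrite mulmnE mnm1E (can_eq blkw) (negPf ne).
    rewrite (bigD1 i) //= mulmnE mnm1E eqxx mul1n big1 ?addn0 // => j /andP[_ ji].
    by rewrite mulmnE mnm1E (can_eq blkw) (negPf ji).
  - rewrite mnmDE mulmnE mnm1E (block_eq blkv blkx) [v _ == x _]eq_sym xv.
    case: eqVneq => [->|_] /=; rewrite ?ti /= mul0n add0n mnm_sumE big1 // => j _;
    by rewrite mulmnE mnm1E [w _ == _]eq_sym (negPf (xNw _ _)).
have Kw c i : K (shift c 'X_(w i)) = if i == i0 then 'X_(v i) *+ c else 'X_(w i).
  rewrite shift_w !rmorphD !rmorphMn /= (_ : K (if _ then _ else _) = 0); last first.
    case ti: (t i); rewrite ?rmorph0 // rmorphMn /=.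
    by have := Kx i; rewrite ti mulr1n => ->; rewrite mul0rn.
  have pN0 : (p.-1 == 0%N) = false by move: p_gt1; lia.
  rewrite addr0 !killX /= mon_w mon_v; case: (eqVneq i i0) => _ /=.
    by rewrite pN0 add0r.
  by rewrite pN0 mul0rn addr0.
have Kc c : (shift c (\prod_i 'X_(w i) ^+ p.-1))@_top = (c%:R : F) ^+ p.-1.
  rewrite topK !rmorph_prod (bigD1 i0) //= !rmorphXn /= Kw eqxx.
  rewrite (eq_bigr (fun i => 'X_(w i) ^+ p.-1)) => [|i /negPf ne]; last first.
    by rewrite !rmorphXn /= Kw ne.
  rewrite -['X_(v i0) *+ c]mulr_natl exprMn -mulrA -topE -(rmorph_nat (@mpolyC n F)) -rmorphXn /=.
  by rewrite mcoeffCM mcoeffX eqxx mulr1.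
(* By Fermat c^(p-1) is 1 except at c = 0, and the [p] ones add up to 0. *)
rewrite raddf_sum /= (eq_bigr (fun c : 'I_p => 1 - (c == 0%N :> nat)%:R)) => [|c _].
  rewrite sumrB sumr_const card_ord (pcharf0 chFp) sub0r; congr (- _).
  rewrite (bigD1 (Ordinal (ltnW p_gt1))) //= big1 ?addr0 // => c.
  by rewrite -val_eqE /= => /negPf ->.
rewrite Kc; have := @fermat_pchar _ _ chFp 1 (oner_neq0 F) c 0 (ltn_ord c) (ltnW p_gt1).
by rewrite expr1n mulr0n subr0 => <-; rewrite subKr.
Qed.

(** If every generator had degree below that of [top], the coefficient at [top] would vanish on the
    whole algebra, against [top_transfer]. *)
Lemma generation_degree_ge d (S : {mpoly F[n]} -> Prop) :
    (forall f, S f -> exists2 e, (e <= d)%N & f \is e.-homog) ->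
    (forall f, inv f <-> subalg_gen S f) ->
  (k * (p - 1) <= d)%N.
Proof.
move=> Sd Sinv; rewrite leqNgt; apply/negP => lt_d.
have gen0 f : subalg_gen S f -> f@_top = 0.
  elim=> [g Sg|c|g h _ ? _ ?|g h genf ? geng ?].
  - have [e le_ed ghom] := Sd _ Sg; apply: (dhomog_nemf_coeff ghom).
    by rewrite /= mdeg_top gtn_eqF // (leq_ltn_trans le_ed).
  - by rewrite mcoeffC -mdeg_eq0 mdeg_top gtn_eqF ?mulr0 // (leq_ltn_trans _ lt_d).
  - by rewrite mcoeffD (_ : g@_top = 0) // add0r.
  - by apply: inv_mul_coef_top => //; apply/Sinv.
have /Sinv/gen0/eqP := inv_transfer (\prod_i 'X_(w i) ^+ p.-1).
by rewrite top_transfer oppr_eq0 oner_eq0.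
Qed.

End LowerBound.

End Shift.

(** * Representations of Z/p *)

Section LinearSubstitution.

Variables (F : fieldType) (n : nat).

Definition lin_subst (A : 'M[F]_n) (f : {mpoly F[n]}) : {mpoly F[n]} :=
  f \mPo [tuple \sum_(j < n) A j i *: 'X_j | i < n].

Lemma lin_substX A i : lin_subst A 'X_i = \sum_(j < n) A j i *: 'X_j.
Proof. by rewrite /lin_subst comp_mpolyXU -tnth_nth tnth_mktuple. Qed.

Lemma lin_substC A c : lin_subst A c%:MP = c%:MP.
Proof. exact: comp_mpolyC. Qed.

Lemma lin_substD A f g : lin_subst A (f + g) = lin_subst A f + lin_subst A g.
Proof. exact: raddfD. Qed.

Lemma lin_substM A f g : lin_subst A (f * g) = lin_subst A f * lin_subst A g.
Proof. exact: rmorphM. Qed.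

Lemma lin_subst_mul A B f : lin_subst (A *m B) f = lin_subst A (lin_subst B f).
Proof.
elim/mpoly_gen_ind: f => [a|i|f g IHf IHg|f g IHf IHg].
- by rewrite !lin_substC.
- rewrite !lin_substX [RHS]linear_sum /=.
  rewrite [RHS](eq_bigr (fun l => \sum_j (A j l * B l i) *: 'X_j)) => [|l _].
    by rewrite [RHS]exchange_big; apply: eq_bigr => j _; rewrite mxE scaler_suml.
  rewrite comp_mpolyZ -/(lin_subst A 'X_l) lin_substX scaler_sumr.
  by apply: eq_bigr => j _; rewrite scalerA mulrC.
- by rewrite !lin_substD IHf IHg.
- by rewrite !lin_substM IHf IHg.
Qed.

Lemma lin_subst1 f : lin_subst 1%:M f = f.
Proof.
elim/mpoly_gen_ind: f => [a|i|f g IHf IHg|f g IHf IHg].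
- by rewrite lin_substC.
- rewrite lin_substX (bigD1 i) //= mxE eqxx scale1r big1 ?addr0 // => j ne.
  by rewrite mxE (negPf ne) scale0r.
- by rewrite lin_substD IHf IHg.
- by rewrite lin_substM IHf IHg.
Qed.

End LinearSubstitution.

(* The matrix A of the generator is, up to renaming the coordinates, a direct
   sum of k Jordan blocks with coordinate functions w, v, x (if t) or w, v = x. *)
Definition has_jordan_blocks (F : fieldType) n (A : 'M[F]_n) k : Prop :=
  exists (blk : 'I_n -> 'I_k) (x v w : 'I_k -> 'I_n) (t : 'I_k -> bool),
    [/\ [/\ cancel x blk, cancel v blk & cancel w blk],
        [/\ forall i, w i != v i, forall i, w i != x i &
            forall i, (x i == v i) = ~~ t i],
        forall j, [|| j == w (blk j), j == v (blk j) | j == x (blk j)] &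
        forall i j, [/\ A j (w i) = ((j == w i) || (j == v i))%:R,
                        A j (v i) = ((j == v i) || t i && (j == x i))%:R &
                        A j (x i) = (j == x i)%:R]].

Lemma has_jordan_blocks0 (F : fieldType) (A : 'M[F]_0) : has_jordan_blocks A 0.
Proof.
pose o := fun i : 'I_0 => i; exists o, o, o, o, (fun=> false).
by split=> [||[]|[]] //; split=> // -[].
Qed.

Lemma has_jordan_blocks_diag (F : fieldType) n1 n2 (A1 : 'M[F]_n1) (A2 : 'M[F]_n2)
    k1 k2 : has_jordan_blocks A1 k1 -> has_jordan_blocks A2 k2 ->
  has_jordan_blocks (block_mx A1 0 0 A2) (k1 + k2).
Proof.
case=> blk1 [x1 [v1 [w1 [t1 [[x1K v1K w1K] [wv1 wx1 xv1] cov1 col1]]]]].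
case=> blk2 [x2 [v2 [w2 [t2 [[x2K v2K w2K] [wv2 wx2 xv2] cov2 col2]]]]].
pose sum2 a1 a2 b1 b2 (f1 : 'I_a1 -> 'I_b1) (f2 : 'I_a2 -> 'I_b2) i :=
  match split i with inl j => lshift b2 (f1 j) | inr j => rshift b1 (f2 j) end.
have sum2l a1 a2 b1 b2 f1 f2 i :
    @sum2 a1 a2 b1 b2 f1 f2 (lshift a2 i) = lshift b2 (f1 i).
  by rewrite /sum2 (unsplitK (inl i)).
have sum2r a1 a2 b1 b2 f1 f2 i :
    @sum2 a1 a2 b1 b2 f1 f2 (rshift a1 i) = rshift b1 (f2 i).
  by rewrite /sum2 (unsplitK (inr i)).
pose t i := match split i with inl j => t1 j | inr j => t2 j end.
have tl i : t (lshift k2 i) = t1 i by rewrite /t (unsplitK (inl i)).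
have tr i : t (rshift k1 i) = t2 i by rewrite /t (unsplitK (inr i)).
exists (sum2 _ _ _ _ blk1 blk2), (sum2 _ _ _ _ x1 x2), (sum2 _ _ _ _ v1 v2),
  (sum2 _ _ _ _ w1 w2), t.
have lrE := (eq_lshift, eq_rshift, eq_lrshift, eq_rlshift).
split.
- by split=> i; case: (split_ordP i) => j ->; rewrite ?(sum2l, sum2r) ?(x1K, x2K, v1K, v2K, w1K, w2K).
- by split=> i; case: (split_ordP i) => j ->;
    rewrite ?(sum2l, sum2r) ?lrE ?(tl, tr) ?(wv1, wv2, wx1, wx2, xv1, xv2).
- by move=> i; case: (split_ordP i) => j ->; rewrite ?(sum2l, sum2r) ?lrE ?cov1 ?cov2.
move=> i j; case: (split_ordP i) => i' ->; case: (split_ordP j) => j' ->;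
  rewrite ?(sum2l, sum2r) ?(block_mxEul, block_mxEur, block_mxEdl, block_mxEdr)
    ?lrE ?(tl, tr) ?mxE ?andbF //.
Qed.

Section ZpRepresentations.

Variables (F : fieldType) (p : nat).
Hypotheses (chFp : p \in [pchar F]) (p_gt2 : (2 < p)%N).

Local Notation rep := (representation F [set: 'Z_p]).

Definition has_blocks (V : rep) k := has_jordan_blocks (V (Zp1 : 'Z_p)) k.

Lemma has_blocks_dadd (V1 V2 : rep) k1 k2 :
  has_blocks V1 k1 -> has_blocks V2 k2 -> has_blocks (dadd_grepr V1 V2) (k1 + k2).
Proof. exact: has_jordan_blocks_diag. Qed.

Lemma has_blocks_muln (V : rep) k m : has_blocks V k -> has_blocks (muln_grepr V m) (m * k).
Proof.
move=> Vk; rewrite /muln_grepr; elim: m => [|m IHm].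
  by rewrite big_ord0; apply: has_jordan_blocks0.
by rewrite big_ord_recl mulSn; apply: has_blocks_dadd.
Qed.

Lemma Vrep_generator q (le_qp : (q <= p)%N) :
  Vrep chFp le_qp (Zp1 : 'Z_p) = jordan_block F q.
Proof. by []. Qed.

Lemma has_blocks_V2 (le_2p : (2 <= p)%N) : has_blocks (Vrep chFp le_2p) 1.
Proof.
rewrite /has_blocks Vrep_generator.
(* Coordinate functions transform by the columns of the Jordan block, so [w] is the last coordinate
   and the first one is invariant. *)
exists (fun=> ord0), (fun=> ord0), (fun=> ord0), (fun=> ord_max), (fun=> false).
split; first by split=> i; rewrite [RHS]ord1.
- by [].
- by case=> [[|[|]]].
move=> i; case=> [[|[|]]] // ltj; rewrite !mxE //.
Qed.

Lemma has_blocks_V3 (le_3p : (3 <= p)%N) : has_blocks (Vrep chFp le_3p) 1.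
Proof.
rewrite /has_blocks Vrep_generator.
exists (fun=> ord0), (fun=> ord0), (fun=> inord 1), (fun=> ord_max), (fun=> true).
have i1 : inord 1 = Ordinal (isT : (1 < 3)%N) by apply/val_inj; rewrite /= inordK.
rewrite i1; split; first by split=> i; rewrite [RHS]ord1.
- by [].
- by case=> [[|[|[|]]]].
by move=> i; case=> [[|[|[|]]]] // ltj; rewrite !mxE.
Qed.

Section Noether.

Variables (V : rep) (k : nat).
Hypotheses (Vk : has_blocks V k) (k_gt2 : (2 < k)%N).

Lemma noether_number_bounds : exists2 b : nat,
  is_noether_number V b & (k * (p - 1) <= b <= k * (p - 1) + 1)%N.
Proof.
have p_gt1 : (1 < p)%N := ltnW p_gt2.
have [blk [x [v [w [t [[xK vK wK] [wv wx xv] cov col]]]]]] := Vk.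
pose sh := @shift F _ _ blk x v w t.
have gen1 f : lin_subst (V (Zp1 : 'Z_p)) f = sh 1%N f.
  elim/mpoly_gen_ind: f => [a|j|f g IHf IHg|f g IHf IHg].
  - by rewrite lin_substC /sh shiftC.
  - have sum1 j' : \sum_j (j == j')%:R *: 'X_j = 'X_j' :> {mpoly F[rdegree V]}.
      rewrite (bigD1 j') //= eqxx scale1r big1 ?addr0 // => l /negPf->.
      by rewrite scale0r.
    have sum2 a b : a != b ->
        \sum_j ((j == a) || (j == b))%:R *: 'X_j = 'X_a + 'X_b :> {mpoly F[rdegree V]}.
      move=> ne; rewrite -(sum1 a) -(sum1 b) -big_split; apply: eq_bigr => l _ /=.
      rewrite -scalerDl -natrD; congr (_%:R *: _).
      by case: (eqVneq l a) => [->|]; rewrite ?(negPf ne).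
    rewrite /sh lin_substX; elim/(var_ind cov): j => i.
    + rewrite shift_w // bin_small // mulr0n if_same addr0 mulr1n -(sum2 _ _ (wv i)).
      by apply: eq_bigr => l _; have [-> _ _] := col i l.
    + rewrite shift_v // mulr1n; case ti: (t i); last first.
        rewrite addr0 -sum1; apply: eq_bigr => l _.
        by have [_ -> _] := col i l; rewrite ti orbF.
      rewrite -sum2; last by rewrite eq_sym xv ti.
      by apply: eq_bigr => l _; have [_ -> _] := col i l; rewrite ti.
    + rewrite shift_x // -sum1; apply: eq_bigr => l _.
      by have [_ _ ->] := col i l.
  - by rewrite lin_substD rmorphD IHf IHg.
  - by rewrite lin_substM rmorphM IHf IHg.
have invP f : poly_invariant f <-> inv blk x v w t f.
  (* [poly_act] inverts its argument, so the inverse of the generator yields [shift 1]. *)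
  split=> [/(_ (Zp1 : 'Z_p)^-1%g (in_setT _))|].
    rewrite /poly_act invgK -/(lin_subst _ f) gen1; exact.
  rewrite /inv -/sh -gen1 => invf g _.
  rewrite /poly_act -/(lin_subst _ f).
  have -> : (g^-1 = (Zp1 : 'Z_p) ^+ nat_of_ord g^-1)%g by rewrite -[LHS]natr_Zp.
  elim: (nat_of_ord _) => [|c IHc]; first by rewrite expg0 repr_mx1 lin_subst1.
  by rewrite expgS repr_mxM ?in_setT // lin_subst_mul IHc.
have gen_ge d : invariants_generated_upto V d -> (k * (p - 1) <= d)%N.
  case=> S [Sd Sinv]; apply: (generation_degree_ge chFp p_gt2 xK vK wK wv wx xv cov k_gt2 (Ordinal (ltnW (ltnW k_gt2))) Sd).
  by move=> f; rewrite -invP.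
have gen_D : invariants_generated_upto V (k * (p - 1) + 1).
  exists (low_inv blk x v w t (k * (p - 1) + 1)); split=> [f []//|f].
  rewrite invP; split; first exact: low_inv_generate.
  exact: low_inv_sound.
(* Only two values are left; excluded middle decides whether degree k (p - 1) already suffices. *)
have [gen0|ngen0] := Classical_Prop.classic (invariants_generated_upto V (k * (p - 1))).
  by exists (k * (p - 1))%N; [split | rewrite leqnn leq_addr].
exists (k * (p - 1) + 1)%N; last by rewrite leq_addr leqnn.
split=> // e gen_e; rewrite addn1 ltn_neqAle gen_ge // andbT.
by apply: contra_notN ngen0 => /eqP->.
Qed.

End Noether.

End ZpRepresentations.

Local Close Scope ring_scope.

Theorem corollary3p8 (F : fieldType) (p m l : nat)
    (chFp : p \in [pchar F]%R) (p_gt2 : 2 < p) (ml_gt2 : 2 < m + l) :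
  exists2 b : nat,
    is_noether_number
      (dadd_grepr (muln_grepr (Vrep chFp (ltnW p_gt2)) m)
                  (muln_grepr (Vrep chFp p_gt2) l)) b
    & (m + l) * (p - 1) <= b <= (m + l) * (p - 1) + 1.
Proof.
apply: (noether_number_bounds chFp p_gt2) => //.
have V2 := has_blocks_muln m (has_blocks_V2 chFp (ltnW p_gt2)).
have V3 := has_blocks_muln l (has_blocks_V3 chFp p_gt2).
by have := has_blocks_dadd V2 V3; rewrite !muln1.
Qed.
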